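(* Let $X$ be a compact metric space such that: (1) $X=\bigcup_{n\geq 1}a_n$, where each $a_n$ is a compact arc with extreme points $p_n,q_n\in X$ for all $n\geq 1$; (2) $a_n\setminus\{p_n,q_n\}$ is a free arc for all $n\geq 1$; and (3) for all $f\in\mathcal{H}(X)$ it holds that $f(a_n)=a_n$, $f(p_n)=p_n$ and $f(q_n)=q_n$ for all $n\geq 1$. Then $\mathcal{H}(X)$ has a $G_\delta$ dense conjugacy class.
   Context: For a compact metric space $(X,\mathrm{dist})$, $\mathcal{H}(X)$ denotes the space of homeomorphisms $f\colon X\to X$ with the $C^0$ distance $\mathrm{dist}_{C^0}(f,g)=\sup\{\mathrm{dist}(f(x),g(x)),\ \mathrm{dist}(f^{-1}(x),g^{-1}(x)) : x\in X\}$. Two homeomorphisms $f,g\in\mathcal{H}(X)$ are conjugate if there is $h\in\mathcal{H}(X)$ with $f\circ h=h\circ g$; the conjugacy class of $f$ is the set of all homeomorphisms conjugate to $f$. A set is $G_\delta$ if it is a countable intersection of open sets. A compact arc is a subspace homeomorphic to $[0,1]$, and its extreme points are the points corresponding to $0$ and $1$. A free arc of $X$ is an open subset $U\subset X$ that is homeomorphic to $\mathbb{R}$. *)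

(* Defs.v *)
From HB Require Import structures.
From mathcomp Require Import all_boot all_order all_algebra.
From mathcomp Require Import all_classical all_reals all_analysis.
Set Implicit Arguments.
Unset Strict Implicit.
Unset Printing Implicit Defensive.
Import Order.TTheory GRing.Theory Num.Theory.
Import numFieldNormedType.Exports.
Local Open Scope classical_set_scope.
Local Open Scope ring_scope.

Section Arcs.

(* f restricts to a homeomorphism from the subspace A onto the subspace B, and
   g to its inverse; the values of f outside A and of g outside B are
   irrelevant. *)
Definition homeomorphism_on (T U : topologicalType) (A : set T) (B : set U)
    (f : T -> U) (g : U -> T) : Prop :=
  [/\ {within A, continuous f} /\ {within B, continuous g},
      f @` A `<=` B, g @` B `<=` A,
      {in A, cancel f g} & {in B, cancel g f}].

Definition compact_arc (R : realType) (X : topologicalType)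
    (a : set X) (p q : X) : Prop :=
  exists (h : R -> X) (g : X -> R),
    [/\ homeomorphism_on (`[0, 1] : set R) a h g, h 0 = p & h 1 = q].

Definition free_arc (R : realType) (X : topologicalType) (U : set X) : Prop :=
  open U /\
  exists (h : R -> X) (g : X -> R), homeomorphism_on [set: R] U h g.

End Arcs.

(* The compactness proof cX is a parameter of the type because it is what
   makes the supremum C0dist finite, hence a distance. *)
Record homeo (R : realType) (X : metricType R) (cX : compact [set: X]) :=
  Homeo {
    homeo_fun :> X -> X ;
    homeo_inv : X -> X ;
    homeo_continuous : continuous homeo_fun ;
    homeo_inv_continuous : continuous homeo_inv ;
    homeoK : cancel homeo_fun homeo_inv ;
    homeo_invK : cancel homeo_inv homeo_fun }.

Section HomeoSpace.
Context (R : realType) (X : metricType R) (cX : compact [set: X]).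
Implicit Types f g h : homeo cX.

Lemma homeo_eq f g : homeo_fun f = homeo_fun g -> f = g.
Proof.
case: f => f f' cf cf' fK f'K; case: g => g g' cg cg' gK g'K /= fg; subst g.
have fg' : f' = g' by apply/funext => x; rewrite -{1}(g'K x) fK.
by subst g'; congr Homeo; exact: Prop_irrelevance.
Qed.

Definition C0set f g : set R :=
  range (fun x => mdist (f x) (g x)) `|`
  range (fun x => mdist (homeo_inv f x) (homeo_inv g x)).

Definition C0dist f g : R := sup (C0set f g).

Lemma mdist_bounded : exists M : R, forall x y : X, mdist x y <= M.
Proof.
have [[x0]|X0] := pselect (inhabited X); last first.
  by exists 0 => x; case: X0.
have /compact_near_coveringP/(_ nat \oo (fun n x => mdist x0 x <= n%:R)) := cX.
case=> [x _|N _ /(_ N (leqnn N)) hN]; last first.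
  exists (N%:R *+ 2) => x y; apply: le_trans (metric_triangle x x0 y) _.
  by rewrite mulr2n metric_sym lerD //; exact: hN.
exists (ball x 1, [set n | (Num.truncn (mdist x0 x + 1)).+1 <= n]%N).
  by split; [exact: nbhsx_ballx | exists (Num.truncn (mdist x0 x + 1)).+1].
case=> y n [/=]; rewrite ballEmdist /= => /ltW xy hn.
apply: le_trans (metric_triangle x0 x y) _.
apply: le_trans (lerD (lexx _) xy) _.
by apply/ltW; apply: lt_le_trans (truncnS_gt _) _; rewrite ler_nat.
Qed.

Lemma C0set_ubound f g : has_ubound (C0set f g).
Proof.
by have [M hM] := mdist_bounded; exists M => _ [] [x _ <-]; exact: hM.
Qed.

Lemma C0dist_ub f g x : mdist (f x) (g x) <= C0dist f g.
Proof. by apply: ub_le_sup; [exact: C0set_ubound | left; exists x]. Qed.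

Lemma C0dist_inv_ub f g x :
  mdist (homeo_inv f x) (homeo_inv g x) <= C0dist f g.
Proof. by apply: ub_le_sup; [exact: C0set_ubound | right; exists x]. Qed.

Lemma C0dist_le f g (M : R) : 0 <= M ->
  (forall x, mdist (f x) (g x) <= M) ->
  (forall x, mdist (homeo_inv f x) (homeo_inv g x) <= M) ->
  C0dist f g <= M.
Proof.
move=> M0 h1 h2; rewrite /C0dist.
have [->|/set0P ne] := eqVneq (C0set f g) set0; first by rewrite sup0.
by apply: ge_sup => // _ [] [x _ <-].
Qed.

Lemma C0dist_ge0 f g : 0 <= C0dist f g.
Proof.
have [[x0]|X0] := pselect (inhabited X).
  by apply: le_trans (C0dist_ub f g x0); exact: mdist_ge0.
rewrite /C0dist [C0set f g](_ : _ = set0) ?sup0 //.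
by apply/seteqP; split => // r [] [x]; case: X0.
Qed.

Lemma C0distxx f : C0dist f f = 0.
Proof.
apply/eqP; rewrite eq_le C0dist_ge0 andbT.
by apply: C0dist_le => // x; rewrite mdistxx.
Qed.

Lemma C0dist_positivity f g : C0dist f g = 0 -> f = g.
Proof.
move=> fg0; apply/homeo_eq/funext => x; apply: mdist_positivity.
by apply/eqP; rewrite eq_le mdist_ge0 andbT -fg0 C0dist_ub.
Qed.

Lemma C0dist_sym f g : C0dist f g = C0dist g f.
Proof.
rewrite /C0dist /C0set; congr (sup (_ `|` _));
  by apply: eq_imagel => x _; exact: metric_sym.
Qed.

Lemma C0dist_triangle g f h : C0dist f h <= C0dist f g + C0dist g h.
Proof.
apply: C0dist_le => [|x|x]; first by rewrite addr_ge0 ?C0dist_ge0.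
- by apply: le_trans (metric_triangle _ (g x) _) _; rewrite lerD ?C0dist_ub.
- by apply: le_trans (metric_triangle _ (homeo_inv g x) _) _;
    rewrite lerD ?C0dist_inv_ub.
Qed.

HB.instance Definition _ := gen_eqMixin (homeo cX).
HB.instance Definition _ := gen_choiceMixin (homeo cX).
HB.instance Definition _ := @isMetric.Build R (homeo cX) C0dist
  C0distxx C0dist_positivity C0dist_sym C0dist_triangle.

Definition conjugate f g : Prop :=
  exists h, homeo_fun f \o homeo_fun h = homeo_fun h \o homeo_fun g.

Definition conjugacy_class f : set (homeo cX) := [set g | conjugate g f].

End HomeoSpace.

(* Main.v *)
Require Import Defs.
From mathcomp Require Import all_boot all_order all_algebra.
From mathcomp Require Import all_classical all_reals all_analysis.
From mathcomp Require Import borel_hierarchy.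
From mathcomp Require Import zify ring lra.
Set Implicit Arguments.
Unset Strict Implicit.
Unset Printing Implicit Defensive.
Import Order.TTheory GRing.Theory Num.Theory.
Import numFieldNormedType.Exports.
Local Open Scope classical_set_scope.
Local Open Scope ring_scope.

(** A homeomorphism of [X] fixes the ends of every arc, so in a parametrization
    of an arc by [[0, 1]] it becomes an increasing bijection of [[0, 1]], its
    chart.  Call such a bijection [F] generic if near each of its fixed points,
    0 and 1 included, there are [x < y < z] with [x < F x], [F y < y] and
    [z < F z].  The homeomorphisms all of whose charts are generic form one
    conjugacy class, and this class is a dense G-delta.

    One class.  The components of the complement of the fixed point set of a
    generic [F], labelled by the sign of [F x - x], form a countable dense order
    without ends in which both labels are dense; [right_dense] is the form in
    which this is used.  (Asking only for both signs near each fixed point would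
    allow an isolated fixed point where [F] crosses the diagonal.)  Hence two
    generic bijections [F] and [G] are conjugate by a back-and-forth argument:
    [partial_conj_extend] extends an isomorphism between finitely many orbits of
    [G] and of [F] by one more orbit, the union of these isomorphisms matches
    dense subsets of [[0, 1]], and its monotone extension conjugates [G] to [F]
    ([generic_conjugate]).

    Gluing.  An end of an arc cannot lie in the interior of another arc, because
    each point of this interior is moved by some homeomorphism supported in it
    ([endpoint_interior]).  By connectedness two arcs whose interiors meet are
    equal ([overlap_eq]), so conjugacies on the separate arcs define a bijection
    of [X].  It is continuous although infinitely many arcs may accumulate at an
    end [x]: there are arbitrarily small radii [r] for which the sphere of centre
    [x] and radius [r] contains no end of an arc, such a sphere is covered by
    finitely many interiors, and every other arc stays on one side of it
    ([glue_continuous]).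

    Dense G-delta.  Genericity is the conjunction of countably many conditions
    [near_generic].  Each of them is open in the C0 topology, and dense because a
    small perturbation supported near a fixed point creates the required pattern
    ([perturb]).  The C0 distance is complete on a compact space
    ([homeo_complete]), and Baire's theorem concludes. *)

(** * Increasing bijections of the unit interval and their iterates *)

(** Extending by the identity outside the unit interval removes the domain
    conditions from composition, inversion and iteration.  Continuity is a
    consequence of monotonicity and bijectivity ([ua_continuous]). *)
Record unit_auto (R : realType) := UnitAuto {
  ua_fun :> R -> R ;
  ua_inv : R -> R ;
  uaK : cancel ua_fun ua_inv ;
  ua_invK : cancel ua_inv ua_fun ;
  ua_lt : {mono ua_fun : x y / x < y} ;
  ua_out : forall x, ~~ (0 < x < 1) -> ua_fun x = x }.

Section UnitAuto.
Context {R : realType}.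
Implicit Types (F G : unit_auto R) (x y t : R) (k l m : int).

Lemma ua_inv_lt F : {mono ua_inv F : x y / x < y}.
Proof. by move=> x y; rewrite -[in RHS](ua_invK F x) -[in RHS](ua_invK F y) ua_lt. Qed.

Lemma ua_inv_out F x : ~~ (0 < x < 1) -> ua_inv F x = x.
Proof. by move=> /(ua_out F) {1}<-; rewrite uaK. Qed.

Definition uaV F : unit_auto R :=
  UnitAuto (ua_invK F) (uaK F) (ua_inv_lt F) (@ua_inv_out F).

Lemma ua_le F : {mono ua_fun F : x y / x <= y}.
Proof. by move=> x y; rewrite !leNgt ua_lt. Qed.

Lemma ua_lt_inv F x y : (F x < y) = (x < ua_inv F y).
Proof. by rewrite -{1}(ua_invK F y) ua_lt. Qed.

Lemma ua_inv_gt F x y : (x < F y) = (ua_inv F x < y).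
Proof. by rewrite -{1}(ua_invK F x) ua_lt. Qed.

Lemma ua_le_inv F x y : (F x <= y) = (x <= ua_inv F y).
Proof. by rewrite !leNgt ua_inv_gt. Qed.

Lemma ua0 F : F 0 = 0. Proof. by apply: ua_out; rewrite ltxx. Qed.
Lemma ua1 F : F 1 = 1. Proof. by apply: ua_out; rewrite ltxx andbF. Qed.

Lemma ua_itv F x : (0 < F x < 1) = (0 < x < 1).
Proof. by rewrite -[X in X < F x](ua0 F) -[X in F x < X](ua1 F) !ua_lt. Qed.

Lemma ua_cc F x : (0 <= F x <= 1) = (0 <= x <= 1).
Proof. by rewrite -[X in X <= F x](ua0 F) -[X in F x <= X](ua1 F) !ua_le. Qed.

Lemma ua_moved F x : F x != x -> 0 < x < 1.
Proof. by apply: contraNT => /(ua_out F) ->. Qed.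

Definition zpow F (k : int) : R -> R :=
  match k with Posz n => iter n F | Negz n => iter n.+1 (ua_inv F) end.

Lemma zpowS F k x : zpow F (k + 1) x = F (zpow F k x).
Proof.
case: k => [n|[|n]]; first by rewrite addrC -intS.
- by rewrite NegzE addNr /= ua_invK.
- rewrite (_ : Negz n.+1 + 1 = Negz n) /=; last by lia.
  by rewrite ua_invK.
Qed.

Lemma zpowP F k x : zpow F (k - 1) x = ua_inv F (zpow F k x).
Proof. by rewrite -{2}(subrK 1 k) zpowS uaK. Qed.

Lemma zpowD F k l x : zpow F (k + l) x = zpow F k (zpow F l x).
Proof.
elim/int_rect: k => [|n IH|n IH]; first by rewrite add0r.
- by rewrite intS [1 + _]addrC addrAC !zpowS IH.
- by rewrite intS opprD [- 1 + _]addrC addrAC !zpowP IH.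
Qed.

Lemma zpowN F k x : zpow F (- k) (zpow F k x) = x.
Proof. by rewrite -zpowD addNr. Qed.

Lemma zpow_lt F k : {mono zpow F k : x y / x < y}.
Proof.
move=> x y; elim/int_rect: k => [//|n IH|n IH].
- by rewrite intS [1 + _]addrC !zpowS ua_lt.
- by rewrite intS opprD [- 1 + _]addrC !zpowP ua_inv_lt.
Qed.

Lemma zpow_itv F k x : (0 < zpow F k x < 1) = (0 < x < 1).
Proof.
elim/int_rect: k => [//|n IH|n IH].
- by rewrite intS [1 + _]addrC !zpowS ua_itv.
- by rewrite intS opprD [- 1 + _]addrC !zpowP (ua_itv (uaV F)).
Qed.

Lemma zpow_lt_shift F k l x y :
  (zpow F k x < zpow F l y) = (x < zpow F (l - k) y).
Proof. by rewrite -(zpow_lt F (- k)) zpowN -zpowD addrC. Qed.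

Lemma zpow_comm F k x : zpow F k (F x) = F (zpow F k x).
Proof. by rewrite -zpowS zpowD. Qed.

Lemma zpow_move F k x : F x != x -> F (zpow F k x) != zpow F k x.
Proof. by apply: contra_neq => h; rewrite -[LHS](zpowN F k) zpow_comm h zpowN. Qed.

Lemma zpow_incr F x : x < F x -> forall k l, (zpow F k x < zpow F l x) = (k < l).
Proof.
move=> xF; apply: leW_mono; apply: le_mono => k l kl.
have -> : l = k + 1 + (`|l - k|.-1)%:Z by lia.
elim: (`|l - k|.-1)%N => [|n IH].
  by rewrite addr0 zpowD zpow_lt.
apply: (lt_trans IH).
rewrite (_ : k + 1 + n.+1%:Z = k + 1 + n%:Z + 1); last by lia.
by rewrite [ltRHS]zpowD zpow_lt.
Qed.

Lemma zpow_decr F x : F x < x -> forall k l, (zpow F k x < zpow F l x) = (l < k).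
Proof.
move=> xF; apply: leW_nmono; apply: le_nmono => k l kl.
have -> : k = l + 1 + (`|k - l|.-1)%:Z by lia.
elim: (`|k - l|.-1)%N => [|n IH].
  by rewrite addr0 zpowD zpow_lt.
apply: lt_trans IH.
rewrite (_ : l + 1 + n.+1%:Z = l + 1 + n%:Z + 1); last by lia.
by rewrite [ltLHS]zpowD zpow_lt.
Qed.

Lemma iter_le F t (p : nat) : F t <= t -> zpow F p t <= t.
Proof.
move=> h; elim: p => [//|p IH]; apply: le_trans h.
by rewrite /= ua_le.
Qed.

Lemma iter_ge F t (p : nat) : t <= F t -> t <= zpow F p t.
Proof.
move=> h; elim: p => [//|p IH]; apply: (le_trans h).
by rewrite /= ua_le.
Qed.

(** The hull of an orbit contains no fixed point, so [F] stays on one side of the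
    diagonal there. *)
Lemma hull_sign F y t m n : zpow F m y < t -> t < zpow F n y ->
  (y < F y -> t < F t) /\ (F y < y -> F t < t).
Proof.
move=> mt tn; have := lt_trans mt tn; split=> yF; rewrite ltNge; apply/negP => tF.
- have mn : m < n by rewrite -(zpow_incr yF).
  suff : zpow F n y < t by rewrite ltNge ltW.
  rewrite (_ : n = (`|n - m|%N)%:Z + m); last by lia.
  by rewrite zpowD; apply: lt_le_trans (iter_le `|n - m| tF); rewrite zpow_lt.
- have mn : n < m by rewrite -(zpow_decr yF).
  suff : t < zpow F m y by rewrite ltNge ltW.
  rewrite (_ : m = (`|m - n|%N)%:Z + n); last by lia.
  by rewrite zpowD; apply: le_lt_trans (iter_ge `|m - n| tF) _; rewrite zpow_lt.
Qed.

(** An orbit is discrete inside its hull: a point of the hull outside the orbit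
    has an orbit point next to it on either side. *)
Lemma orbit_straddle F x0 x : F x0 != x0 -> (forall k, zpow F k x0 != x) ->
  (exists m, zpow F m x0 < x) -> (exists n, x < zpow F n x0) ->
  exists i j, [/\ zpow F i x0 < x, x < zpow F j x0,
    forall m, zpow F m x0 < x -> zpow F m x0 <= zpow F i x0 &
    forall m, x < zpow F m x0 -> zpow F j x0 <= zpow F m x0].
Proof.
move=> mv off [m mx] [n xn].
have ltV k : ~~ (x < zpow F k x0) -> zpow F k x0 < x.
  by rewrite -leNgt le_eqVlt (negPf (off k)).
have gtV k : ~~ (zpow F k x0 < x) -> x < zpow F k x0.
  by rewrite -leNgt le_eqVlt eq_sym (negPf (off k)).
have mn := lt_trans mx xn.
have [xF|Fx|e] := ltgtP x0 (F x0); last by rewrite -e eqxx in mv.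
- have {}mn : m < n by rewrite -(zpow_incr xF).
  have ex : exists p : nat, x < zpow F (m + p) x0.
    by exists `|n - m|%N; rewrite (_ : m + _ = n) //; lia.
  have [[|p] xp minp] := ex_minnP ex; first by move: xp; rewrite addr0 ltNge ltW.
  have px : zpow F (m + p) x0 < x.
    by apply: ltV; apply/negP => /minp; rewrite ltnn.
  exists (m + p), (m + p.+1); split=> // k kx;
    rewrite leNgt (zpow_incr xF); apply/negP => kp.
  + suff : zpow F (m + p.+1) x0 <= zpow F k x0 by rewrite leNgt (lt_trans kx xp).
    by rewrite leNgt (zpow_incr xF) -leNgt; lia.
  + suff : zpow F k x0 <= zpow F (m + p) x0 by rewrite leNgt (lt_trans px kx).
    by rewrite leNgt (zpow_incr xF) -leNgt; lia.
- have {}mn : n < m by rewrite -(zpow_decr Fx).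
  have ex : exists p : nat, zpow F (n + p) x0 < x.
    by exists `|m - n|%N; rewrite (_ : n + _ = m) //; lia.
  have [[|p] px minp] := ex_minnP ex; first by move: px; rewrite addr0 ltNge ltW.
  have xp : x < zpow F (n + p) x0.
    by apply: gtV; apply/negP => /minp; rewrite ltnn.
  exists (n + p.+1), (n + p); split=> // k kx;
    rewrite leNgt (zpow_decr Fx); apply/negP => kp.
  + suff : zpow F (n + p) x0 <= zpow F k x0 by rewrite leNgt (lt_trans kx xp).
    by rewrite leNgt (zpow_decr Fx) -leNgt; lia.
  + suff : zpow F k x0 <= zpow F (n + p.+1) x0 by rewrite leNgt (lt_trans px kx).
    by rewrite leNgt (zpow_decr Fx) -leNgt; lia.
Qed.

End UnitAuto.

(** * Generic bijections and the extension of partial conjugacies *)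

Section Generic.
Context {R : realType}.
Implicit Types (F G : unit_auto R) (x y t c u v : R) (k m : int).

Definition crossing F t e := exists x y z,
  [/\ t - e < x, x < y, y < z & z < t + e] /\ [/\ x < F x, F y < y & z < F z].

Definition generic F := forall t, 0 <= t <= 1 -> F t = t ->
  forall e, 0 < e -> crossing F t e.

(** [F] does not take both signs relative to the diagonal on the open interval. *)
Definition one_signed F u v := forall s t,
  u < s < v -> u < t < v -> s < F s -> F t < t -> False.

(** On the left of [c] only one sign occurs, so at least two consecutive points of
    an above-below-above pattern around [c] lie on the right of [c].  The
    hypothesis on the left holds for [c = 0] and for the supremum of an orbit. *)
Lemma right_dense F c u v : generic F -> 0 <= c <= 1 -> F c = c -> u < c ->
  one_signed F u c -> c < v ->
  (exists s, c < s < v /\ s < F s) /\ (exists t, c < t < v /\ F t < t).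
Proof.
move=> genF c01 Fc uc sgn cv.
have e0 : 0 < Num.min (c - u) (v - c) by rewrite lt_min !subr_gt0 uc.
have [x [y [z [[cx xy yz zc] [Fx Fy Fz]]]]] := genF c c01 Fc _ e0.
have {}cx : u < x.
  by apply: le_lt_trans cx; rewrite lerBrDl -lerBrDr ge_min lexx.
have {}zc : z < v.
  by apply: lt_le_trans zc _; rewrite -lerBrDl ge_min lexx orbT.
have xc : x != c by apply: contraTneq Fx => ->; rewrite Fc ltxx.
have yc : y != c by apply: contraTneq Fy => ->; rewrite Fc ltxx.
have [xlc|clx|e] := ltgtP x c; last by rewrite e eqxx in xc.
- have [ylc|cly|e] := ltgtP y c; last by rewrite e eqxx in yc.
    by case: (sgn x y) => //; rewrite ?cx ?xlc ?ylc ?(lt_trans cx).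
  split; [exists z|exists y]; split=> //.
  + by rewrite zc (lt_trans cly).
  + by rewrite cly (lt_trans yz).
- split; [exists x|exists y]; split=> //.
  + by rewrite clx (lt_trans xy) // (lt_trans yz).
  + by rewrite (lt_trans clx) // (lt_trans yz).
Qed.

Lemma hull_one_signed F y u v :
  F y != y ->
  (forall t, u < t < v -> exists m n, zpow F m y < t < zpow F n y) ->
  one_signed F u v.
Proof.
move=> yF hull s t /hull[m [n /andP[ms sn]]] /hull[m' [n' /andP[mt tn]]] Fs Ft.
have [s1 s2] := hull_sign ms sn.
have [t1 t2] := hull_sign mt tn.
have [/t1|/s2|e] := ltgtP y (F y); last by rewrite -e eqxx in yF.
- by rewrite ltNge ltW.
- by rewrite ltNge ltW.
Qed.

Lemma orbit_sup F y : F y != y -> exists c,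
  [/\ F c = c, one_signed F y c, forall k, zpow F k y < c &
   forall d, (forall k, zpow F k y <= d) -> c <= d].
Proof.
move=> yF; have y01 := ua_moved yF.
pose A := range (fun k => zpow F k y).
have Aub : has_ubound A.
  exists 1 => _ [k _ <-]; apply: ltW.
  by move: y01; rewrite -(zpow_itv F k) => /andP[].
have leA k : zpow F k y <= sup A by apply: ub_le_sup => //; exists k.
have least d : (forall k, zpow F k y <= d) -> sup A <= d.
  by move=> h; apply: ge_sup => [|_ [k _ <-]//]; exists y, 0.
have Fc : F (sup A) = sup A.
  apply/eqP; rewrite eq_le ua_le_inv; apply/andP; split; apply: least => k.
  - by rewrite -ua_le_inv -zpowS.
  - by rewrite -[k](subrK 1) zpowS ua_le.
have ltA k : zpow F k y < sup A.
  rewrite lt_neqAle leA andbT.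
  by apply: contra_neq (zpow_move k yF) => ->.
exists (sup A); split=> //; apply: (hull_one_signed yF) => t /andP[yt tA].
have [n tn] : exists n, t < zpow F n y.
  apply: contrapT => h; move: tA; apply/negP; rewrite -leNgt; apply: least => k.
  by rewrite leNgt; apply/negP => tk; apply: h; exists k.
by exists 0, n; rewrite yt.
Qed.

Lemma orbit_inf F y : F y != y -> exists c,
  [/\ one_signed F c y, forall k, c < zpow F k y &
   forall d, (forall k, d <= zpow F k y) -> d <= c].
Proof.
move=> yF; have y01 := ua_moved yF.
pose A := range (fun k => zpow F k y).
have Alb : has_lbound A.
  exists 0 => _ [k _ <-]; apply: ltW.
  by move: y01; rewrite -(zpow_itv F k) => /andP[].
have geA k : inf A <= zpow F k y by apply: ge_inf => //; exists k.
have greatest d : (forall k, d <= zpow F k y) -> d <= inf A.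
  by move=> h; apply: lb_le_inf => [|_ [k _ <-]//]; exists y, 0.
have Fc : F (inf A) = inf A.
  apply/eqP; rewrite eq_le -[X in _ && X](ua_le (uaV F)) /= uaK.
  apply/andP; split; apply: greatest => k.
  - by rewrite -[k](subrK 1) zpowS ua_le.
  - by rewrite -(ua_le F) ua_invK -zpowS.
have gtA k : inf A < zpow F k y.
  rewrite lt_neqAle geA andbT eq_sym.
  by apply: contra_neq (zpow_move k yF) => ->.
exists (inf A); split=> //; apply: (hull_one_signed yF) => t /andP[tA yt].
have [n tn] : exists n, zpow F n y < t.
  apply: contrapT => h; move: tA; apply/negP; rewrite -leNgt; apply: greatest => k.
  by rewrite leNgt; apply/negP => tk; apply: h; exists k.
by exists n, 0; rewrite tn.
Qed.

(** The pairs in a list stand for whole orbits: [(x, y)] and [(x', y')] are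
    compatible when sending the [m]-th iterate of [x] to that of [y], and likewise
    for [x'] and [y'], preserves the order. *)
Definition compat G F (a b : R * R) := forall m k,
  (zpow G m a.1 < zpow G k b.1) = (zpow F m a.2 < zpow F k b.2).

Definition partial_conj G F (l : seq (R * R)) :=
  (forall a, a \in l -> G a.1 != a.1) /\
  (forall a b, a \in l -> b \in l -> compat G F a b).

Lemma compat_le G F a b m k : compat G F b a ->
  (zpow G m a.1 <= zpow G k b.1) = (zpow F m a.2 <= zpow F k b.2).
Proof. by move=> c; rewrite !leNgt c. Qed.

(** Compatibility of a pair with itself forces the same sign relative to the
    diagonal for [G] at [a.1] and for [F] at [a.2]. *)
Lemma compat_move G F a : compat G F a a -> G a.1 != a.1 -> F a.2 != a.2.
Proof.
move=> c; have := c 0 1; have := c 1 0; rewrite /= => e1 e2.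
by rewrite !neq_lt e1 e2.
Qed.

Lemma partial_conj_sym G F l : partial_conj G F l ->
  partial_conj F G [seq (a.2, a.1) | a <- l].
Proof.
move=> [mv cp]; split.
- by move=> _ /mapP[a al ->] /=; apply: compat_move (mv a al); exact: cp.
- by move=> _ _ /mapP[a al ->] /mapP[b bl ->] m k /=; rewrite cp.
Qed.

Section Extension.
Variables (G F : unit_auto R) (l : seq (R * R)) (x : R).
Hypothesis good : partial_conj G F l.
Hypothesis offG : forall a k, a \in l -> zpow G k a.1 != x.

Let mvG a : a \in l -> G a.1 != a.1. Proof. by case: good => + _ => /[apply]. Qed.
Let cp a b : a \in l -> b \in l -> compat G F a b.
Proof. by case: good => _; exact. Qed.
Let mvF a : a \in l -> F a.2 != a.2.
Proof. by move=> al; apply: compat_move (mvG al); exact: cp. Qed.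

Let below y := forall a k, a \in l -> zpow G k a.1 < x -> zpow F k a.2 < y.
Let above y := forall a k, a \in l -> x < zpow G k a.1 -> y < zpow F k a.2.

(** A listed orbit with points on both sides of [x] has a last point below [x] and
    a first point above it, and any other listed orbit avoids the interval between
    the neighbours of [x] in the orbit of [a0].  So the images of the points below
    and of those above are separated by a gap, and every point of the gap has the
    right sign because it lies in the hull of the orbit of [a0.2]. *)
Lemma extend_straddled a0 : a0 \in l ->
  (exists m, zpow G m a0.1 < x) -> (exists n, x < zpow G n a0.1) ->
  exists y, [/\ below y, above y, x < G x -> y < F y & G x < x -> F y < y].
Proof.
move=> al0 m0 n0.
have [i [j [ix xj lei gej]]] := orbit_straddle (mvG al0) (fun k => offG k al0) m0 n0.
have straddle a : a \in l -> (exists m, zpow G m a.1 < x) ->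
    (exists n, x < zpow G n a.1) -> _ :=
  fun al => orbit_straddle (mvG al) (fun k => offG k al).
have shift (p q k : int) (a : R * R) : zpow G p a0.1 < zpow G k a.1 ->
    zpow G q a0.1 < zpow G (q - p + k) a.1.
  by rewrite !zpow_lt_shift (_ : q - p + k - q = k - p) //; lia.
have shift' (p q k : int) (a : R * R) : zpow G k a.1 < zpow G p a0.1 ->
    zpow G (q - p + k) a.1 < zpow G q a0.1.
  by rewrite !zpow_lt_shift (_ : q - (q - p + k) = p - k) //; lia.
(* [lo] is the greatest image of an orbit point below [x], [hi] the least image of
   one above. *)
have [lo [lo_i lo_B lo_A]] : exists lo, [/\ zpow F i a0.2 <= lo,
    forall b k, b \in l -> x < zpow G k b.1 -> lo < zpow F k b.2 &
    forall a k, a \in l -> zpow G k a.1 < x -> zpow F k a.2 <= lo].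
  suff : forall s : seq (R * R), {subset s <= l} -> exists lo, [/\ zpow F i a0.2 <= lo,
    forall b k, b \in l -> x < zpow G k b.1 -> lo < zpow F k b.2 &
    forall a k, a \in s -> zpow G k a.1 < x -> zpow F k a.2 <= lo].
    by apply.
  elim=> [_|a s IH sl].
    exists (zpow F i a0.2); split=> // b k bl xb.
    by rewrite -(cp al0 bl) (lt_trans ix).
  have al := sl a (mem_head _ _).
  have [|lo [lo_i lo_B lo_s]] := IH.
    by move=> b bs; apply: sl; rewrite inE bs orbT.
  have [na|nna] := pselect (exists n, zpow G n a.1 < x); last first.
    exists lo; split=> // b k; rewrite inE => /orP[/eqP->{b} ax|]; last exact: lo_s.
    by case: nna; exists k.
  have [ab|nab] := pselect (exists n, x < zpow G n a.1); last first.
    exists lo; split=> // b k; rewrite inE => /orP[/eqP->{b} ax|]; last exact: lo_s.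
    apply: le_trans lo_i; rewrite -(compat_le _ _ (cp al0 al)) leNgt.
    apply/negP => /(shift i j) lt; apply: nab; exists (j - i + k).
    exact: lt_trans lt.
  have [i1 [j1 [i1x xj1 lei1 _]]] := straddle a al na ab.
  exists (Num.max lo (zpow F i1 a.2)); split.
  - by rewrite le_max lo_i.
  - by move=> b k bl xb; rewrite gt_max lo_B //= -(cp al bl) (lt_trans i1x).
  - move=> b k; rewrite inE le_max => /orP[/eqP->{b} ax|bs bx]; last by rewrite lo_s.
    by rewrite -(compat_le _ _ (cp al al)) lei1 ?orbT.
have [hi [hi_j lo_hi hi_B]] : exists hi, [/\ hi <= zpow F j a0.2, lo < hi &
    forall b k, b \in l -> x < zpow G k b.1 -> hi <= zpow F k b.2].
  suff : forall s : seq (R * R), {subset s <= l} ->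
    exists hi, [/\ hi <= zpow F j a0.2, lo < hi &
    forall b k, b \in s -> x < zpow G k b.1 -> hi <= zpow F k b.2].
    by apply.
  elim=> [_|a s IH sl].
    by exists (zpow F j a0.2); split=> //; exact: lo_B.
  have al := sl a (mem_head _ _).
  have [|hi [hi_j lo_hi hi_s]] := IH.
    by move=> b bs; apply: sl; rewrite inE bs orbT.
  have [ab|nab] := pselect (exists n, x < zpow G n a.1); last first.
    exists hi; split=> // b k; rewrite inE => /orP[/eqP->{b} ax|]; last exact: hi_s.
    by case: nab; exists k.
  have [na|nna] := pselect (exists n, zpow G n a.1 < x); last first.
    exists hi; split=> // b k; rewrite inE => /orP[/eqP->{b} ax|]; last exact: hi_s.
    apply: (le_trans hi_j); rewrite -(compat_le _ _ (cp al al0)) leNgt.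
    apply/negP => /(shift' j i) lt; apply: nna; exists (i - j + k).
    exact: lt_trans ix.
  have [i1 [j1 [i1x xj1 _ gej1]]] := straddle a al na ab.
  exists (Num.min hi (zpow F j1 a.2)); split.
  - by rewrite ge_min hi_j.
  - by rewrite lt_min lo_hi lo_B.
  - move=> b k; rewrite inE ge_min => /orP[/eqP->{b} ax|bs bx]; last by rewrite hi_s.
    by rewrite -(compat_le _ _ (cp al al)) gej1 ?orbT.
have [lom mhi] := midf_lt lo_hi.
exists ((lo + hi) / 2).
have iy : zpow F i a0.2 < (lo + hi) / 2 by exact: le_lt_trans lo_i _.
have yj : (lo + hi) / 2 < zpow F j a0.2 by exact: lt_le_trans hi_j.
have [s1 s2] := hull_sign iy yj.
have [t1 t2] := hull_sign ix xj.
have e1 := cp al0 al0 0 1; have e2 := cp al0 al0 1 0; rewrite /= in e1 e2.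
split.
- by move=> a k al ax; apply: le_lt_trans lom; exact: lo_A.
- by move=> a k al ax; apply: lt_le_trans mhi _; exact: hi_B.
- move=> xG; apply: s1; rewrite -e1.
  by have := mvG al0; rewrite neq_lt => /orP[/t2|//]; rewrite ltNge ltW.
- move=> xG; apply: s2; rewrite -e2.
  by have := mvG al0; rewrite neq_lt => /orP[//|/t1]; rewrite ltNge ltW.
Qed.

Hypothesis genF : generic F.
Hypothesis mvx : G x != x.

(** Every listed orbit is entirely below or entirely above [x].  Let [c] be the
    supremum of the images of the orbits below, or 0 if there are none, and [d] the
    infimum of the images of those above, or 1.  Then [c] is a fixed point with one sign on its left, so
    [right_dense] excludes [c = d] and provides both signs in between. *)
Lemma extend_unstraddled :
  (forall a, a \in l -> (forall k, zpow G k a.1 < x) \/ (forall k, x < zpow G k a.1)) ->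
  exists y, [/\ below y, above y, x < G x -> y < F y & G x < x -> F y < y].
Proof.
move=> side.
have [c [u [[c01 Fc uc sgnc] c_A c_B]]] : exists c u,
    [/\ [/\ 0 <= c <= 1, F c = c, u < c & one_signed F u c],
      forall a k, a \in l -> zpow G k a.1 < x -> zpow F k a.2 <= c &
      forall b, b \in l -> (forall k, x < zpow G k b.1) ->
        forall k, c <= zpow F k b.2].
  suff : forall s : seq (R * R), {subset s <= l} -> exists c u,
    [/\ [/\ 0 <= c <= 1, F c = c, u < c & one_signed F u c],
      forall a k, a \in s -> zpow G k a.1 < x -> zpow F k a.2 <= c &
      forall b, b \in l -> (forall k, x < zpow G k b.1) ->
        forall k, c <= zpow F k b.2].
    by apply.
  elim=> [_|a s IH sl].
    exists 0, (-1); split=> //; first split.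
    - by rewrite lexx ler01.
    - exact: ua0.
    - by rewrite ltrN10.
    - by move=> t t' /andP[_ t0] _; rewrite ua_out ?ltxx // (lt_gtF t0).
    - move=> b bl _ k; apply: ltW.
      by have := ua_moved (mvF bl); rewrite -(zpow_itv F k) => /andP[].
  have al := sl a (mem_head _ _).
  have [|c [u [[c01 Fc uc sgnc] c_s c_B]]] := IH.
    by move=> b bs; apply: sl; rewrite inE bs orbT.
  have [ax|xa] := side a al; last first.
    exists c, u; split=> // b k; rewrite inE => /orP[/eqP->{b} ax|]; last exact: c_s.
    by have := lt_trans (xa k) ax; rewrite ltxx.
  have [c' [Fc' sgnc' c'_A c'_l]] := orbit_sup (mvF al).
  have [le|/ltW le] := leP c' c.
    exists c, u; split=> // b k; rewrite inE => /orP[/eqP->{b} _|]; last exact: c_s.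
    exact: le_trans (ltW (c'_A k)) le.
  exists c', a.2; split=> //; first split=> //.
  - have /andP[a0 a1] := ua_moved (mvF al).
    rewrite (le_trans _ le) ?(andP c01).1 //=.
    apply: c'_l => k; apply: ltW.
    by have := ua_moved (mvF al); rewrite -(zpow_itv F k) => /andP[].
  - exact: (c'_A 0).
  - move=> b k; rewrite inE => /orP[/eqP->{b} _|bs bx]; first exact: ltW.
    exact: le_trans (c_s _ _ bs bx) le.
  - move=> b bl xb k; apply: c'_l => m.
    by rewrite -(compat_le _ _ (cp bl al)) ltW // (lt_trans (ax m)).
have [d [v [[cd dv sgnd] d_B]]] : exists d v,
    [/\ c <= d, d < v & one_signed F d v] /\
      forall b k, b \in l -> x < zpow G k b.1 -> d <= zpow F k b.2.
  suff : forall s : seq (R * R), {subset s <= l} -> exists d v,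
    [/\ c <= d, d < v & one_signed F d v] /\
      forall b k, b \in s -> x < zpow G k b.1 -> d <= zpow F k b.2.
    by apply.
  elim=> [_|a s IH sl].
    exists 1, 2; split=> //; split.
    - by case/andP: c01.
    - by rewrite ltr1n.
    - by move=> t t' /andP[t1 _] _; rewrite ua_out ?ltxx // (lt_gtF t1) andbF.
  have al := sl a (mem_head _ _).
  have [|d [v [[cd dv sgnd] d_s]]] := IH.
    by move=> b bs; apply: sl; rewrite inE bs orbT.
  have [ax|xa] := side a al.
    exists d, v; split=> // b k; rewrite inE => /orP[/eqP->{b} xa|]; last exact: d_s.
    by have := lt_trans (ax k) xa; rewrite ltxx.
  have [d' [sgnd' d'_B d'_g]] := orbit_inf (mvF al).
  have [le|/ltW le] := leP d d'.
    exists d, v; split=> // b k; rewrite inE => /orP[/eqP->{b} _|]; last exact: d_s.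
    exact: le_trans le (ltW (d'_B k)).
  exists d', a.2; split=> //; first split=> //.
  - by apply: d'_g => k; exact: c_B.
  - exact: (d'_B 0).
  - move=> b k; rewrite inE => /orP[/eqP->{b} _|bs bx]; first exact: ltW.
    exact: le_trans le (d_s _ _ bs bx).
(* If [c = d], there would be one sign on each side of the fixed point [c]. *)
have {v dv sgnd} {}cd : c < d.
  move: cd; rewrite le_eqVlt => /orP[/eqP cd|//].
  rewrite -cd in dv sgnd.
  have [[s [sv Fs]] [t [tv Ft]]] := right_dense genF c01 Fc uc sgnc dv.
  by case: (sgnd s t).
have [[s [/andP[cs sd] Fs]] [t [/andP[ct td] Ft]]] :=
  right_dense genF c01 Fc uc sgnc cd.
have wit y : c < y -> y < d -> below y /\ above y.
  move=> cy yd; split=> a k al ax.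
  - exact: le_lt_trans (c_A _ _ al ax) cy.
  - exact: lt_le_trans yd (d_B _ _ al ax).
have [xG|Gx|e] := ltgtP x (G x); last by case/eqP: mvx.
- by exists s; have [] := wit s cs sd; split=> //; rewrite ltNge ltW.
- by exists t; have [] := wit t ct td; split=> //; rewrite ltNge ltW.
Qed.

End Extension.

(** One step of the back-and-forth construction. *)
Lemma partial_conj_extend G F l x : generic F -> partial_conj G F l ->
  G x != x -> exists y, partial_conj G F ((x, y) :: l).
Proof.
move=> genF good mvx; have [mv cp] := good.
suff [y [yx xy yy]] : exists y, [/\ forall a, a \in l -> compat G F (x, y) a,
     forall a, a \in l -> compat G F a (x, y) & compat G F (x, y) (x, y)].
  exists y; split=> [a|a b]; rewrite !inE => /orP[/eqP->//|]; first exact: mv.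
    by move=> /orP[/eqP->|]; [exact: yy|exact: yx].
  by move=> al /orP[/eqP->|]; [exact: xy|exact: cp].
have [[a [k [al <-]]]|off] := pselect (exists a k, a \in l /\ zpow G k a.1 = x).
  by exists (zpow F k a.2); split=> [b bl|b bl|] m n /=; rewrite -?zpowD cp.
have offG a k : a \in l -> zpow G k a.1 != x.
  by move=> al; apply/eqP => e; apply: off; exists a, k.
have [y [ylt ygt yF Fy]] : exists y,
    [/\ forall a k, a \in l -> zpow G k a.1 < x -> zpow F k a.2 < y,
     forall a k, a \in l -> x < zpow G k a.1 -> y < zpow F k a.2,
     x < G x -> y < F y & G x < x -> F y < y].
  have [[a [al [m0 n0]]]|nstr] := pselect (exists a, a \in l /\
     ((exists m, zpow G m a.1 < x) /\ (exists n, x < zpow G n a.1))).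
    exact: (extend_straddled good offG al).
  apply: (extend_unstraddled good genF mvx) => a al.
  have [na|nna] := pselect (exists m, zpow G m a.1 < x); [left|right] => k.
  - rewrite ltNge le_eqVlt eq_sym (negPf (offG _ _ al)) /=; apply/negP => h.
    by apply: nstr; exists a; split=> //; split=> //; exists k.
  - rewrite ltNge le_eqVlt (negPf (offG _ _ al)) /=; apply/negP => h.
    by apply: nna; exists k.
have iff a k : a \in l -> (x < zpow G k a.1) = (y < zpow F k a.2).
  move=> al; have [/ygt -> //|/ylt h|e] := ltgtP x (zpow G k a.1).
  - by rewrite ltNge ltW ?h.
  - by have := offG a k al; rewrite e eqxx.
have iff' a k : a \in l -> (zpow G k a.1 < x) = (zpow F k a.2 < y).
  move=> al; have [/ylt -> //|/ygt h|e] := ltgtP (zpow G k a.1) x.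
  - by rewrite ltNge ltW ?h.
  - by have := offG a k al; rewrite e eqxx.
exists y; split.
- by move=> a al m k /=; rewrite !zpow_lt_shift iff.
- move=> a al m k /=.
  by rewrite -[LHS](zpow_lt G (- k)) -[RHS](zpow_lt F (- k)) !zpowN -!zpowD iff'.
- move=> m k /=; have [xG|Gx|e] := ltgtP x (G x); last by rewrite -e eqxx in mvx.
  + by rewrite !zpow_incr ?yF.
  + by rewrite !zpow_decr ?Fy.
Qed.

End Generic.

(** * Two generic bijections are conjugate *)

Section DenseExtension.
Context {R : realType}.
Implicit Types (F G H : unit_auto R) (S : set (R * R)) (t u v x y : R).

Lemma ua_comp_lt F G : {mono F \o G : x y / x < y}.
Proof. by move=> x y /=; rewrite !ua_lt. Qed.

Lemma ua_comp_out F G x : ~~ (0 < x < 1) -> (F \o G) x = x.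
Proof. by move=> x01 /=; rewrite !ua_out. Qed.

Definition ua_comp F G : unit_auto R :=
  UnitAuto (can_comp (uaK F) (uaK G)) (can_comp (ua_invK G) (ua_invK F))
    (ua_comp_lt F G) (@ua_comp_out F G).

(** Monotone bijections that differ at a point differ on an interval. *)
Lemma ua_eq_dense F G :
  (forall u v, 0 <= u -> u < v -> v <= 1 -> exists t, u < t < v /\ F t = G t) ->
  forall t, F t = G t.
Proof.
move=> agree t; have [t01|/[dup] /(ua_out F) -> /(ua_out G) -> //] := boolP (0 < t < 1).
wlog lt : F G agree / F t < G t.
  move=> h; have [/(h F G agree)//|GF|//] := ltgtP (F t) (G t).
  apply/esym/(h G F) => // u v u0 uv v1.
  by have [s [suv e]] := agree u v u0 uv v1; exists s.
have [||s [/andP[us st] e]] := agree (ua_inv G (F t)) t _ _ (ltW (andP t01).2).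
- by move: t01; rewrite -(ua_itv F) -(ua_itv (uaV G)) => /andP[/ltW].
- by rewrite -ua_inv_gt.
have : F s < G s by rewrite ua_inv_gt (lt_trans _ us) // ua_inv_lt ua_lt.
by rewrite e ltxx.
Qed.

Lemma unit_auto_ext (phi psi : R -> R) :
  (forall t, 0 < t < 1 -> 0 < phi t < 1 /\ psi (phi t) = t) ->
  (forall t, 0 < t < 1 -> 0 < psi t < 1 /\ phi (psi t) = t) ->
  (forall s t, 0 < s -> s < t -> t < 1 -> phi s < phi t) ->
  exists F : unit_auto R, forall t, 0 < t < 1 -> F t = phi t.
Proof.
move=> phiP psiP phi_lt; pose ext (f : R -> R) t := if 0 < t < 1 then f t else t.
have extK f f' : (forall t, 0 < t < 1 -> 0 < f t < 1 /\ f' (f t) = t) ->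
    cancel (ext f) (ext f').
  move=> fP t; rewrite /ext; have [t01|/negPf e] := boolP (0 < t < 1); last first.
    by rewrite e.
  by have [-> ->] := fP t t01.
have ext_lt : {mono ext phi : x y / x < y}.
  apply: leW_mono; apply: le_mono => x y xy; rewrite /ext.
  have [/andP[x0 x1]|nx] := boolP (0 < x < 1);
    have [/andP[y0 y1]|ny] := boolP (0 < y < 1) => //.
  - exact: phi_lt.
  - have [|/andP[_ px] _] := phiP x; first by rewrite x0.
    by apply: lt_le_trans px _; move: ny; rewrite (lt_trans x0 xy) /= -leNgt.
  - have [|/andP[py _] _] := phiP y; first by rewrite y0.
    by apply: le_lt_trans py; move: nx; rewrite (lt_trans xy y1) andbT -leNgt.
have ext_out t : ~~ (0 < t < 1) -> ext phi t = t by rewrite /ext => /negPf ->.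
exists (UnitAuto (extK _ _ phiP) (extK _ _ psiP) ext_lt ext_out) => t t01.
by rewrite /= /ext t01.
Qed.

(** The monotone extension of the partial function with graph [S]; the value 0 is
    included so that the supremum is taken over a nonempty set. *)
Definition sweep S t := sup ([set 0] `|` [set p.2 | p in [set p | S p /\ p.1 <= t]]).

Definition swap S : set (R * R) := [set p | S (p.2, p.1)].

Definition dense_matching S := [/\ forall p, S p -> 0 < p.2 < 1,
  forall p q, S p -> S q -> (p.1 < q.1) = (p.2 < q.2) &
  forall u v, 0 <= u -> u < v -> v <= 1 -> exists p, S p /\ u < p.1 < v].

Section Sweep.
Variable S : set (R * R).
Hypothesis dS : dense_matching S.
Let S01 p : S p -> 0 < p.2 < 1. Proof. by case: dS => + _ _; exact. Qed.
Let Smono p q : S p -> S q -> (p.1 < q.1) = (p.2 < q.2).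
Proof. by case: dS => _ + _; exact. Qed.

Lemma sweep_ub t : has_ubound ([set 0] `|` [set p.2 | p in [set p | S p /\ p.1 <= t]]).
Proof. by exists 1 => _ [->//|[p [/S01 /andP[_ /ltW p1] _] <-]]. Qed.

Lemma sweep_ge t p : S p -> p.1 <= t -> p.2 <= sweep S t.
Proof. by move=> Sp pt; apply: ub_le_sup; [exact: sweep_ub|right; exists p]. Qed.

Lemma sweep_ge0 t : 0 <= sweep S t.
Proof. by apply: ub_le_sup; [exact: sweep_ub|left]. Qed.

Lemma sweep_le t d : 0 <= d -> (forall p, S p -> p.1 <= t -> p.2 <= d) ->
  sweep S t <= d.
Proof.
by move=> d0 h; apply: ge_sup => [|_ [->//|[p [Sp pt] <-]]]; [exists 0; left|exact: h].
Qed.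

Lemma sweep_lt t p : S p -> t < p.1 -> sweep S t <= p.2.
Proof.
move=> Sp tp; apply: sweep_le => [|q Sq qt]; first by case/andP: (S01 Sp) => /ltW.
by rewrite ltW // -Smono // (le_lt_trans qt).
Qed.

Lemma sweep_pair p : S p -> sweep S p.1 = p.2.
Proof.
move=> Sp; apply/eqP; rewrite eq_le sweep_ge // andbT.
apply: sweep_le => [|q Sq]; first by case/andP: (S01 Sp) => /ltW.
by rewrite !leNgt Smono.
Qed.

Lemma sweep_homo u v : 0 <= u -> u < v -> v <= 1 -> sweep S u < sweep S v.
Proof.
case: dS => _ _ dn u0 uv v1; have [p [Sp /andP[up pv]]] := dn _ _ u0 uv v1.
have [q [Sq /andP[pq qv]]] := dn _ _ (le_trans u0 (ltW up)) pv v1.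
apply: le_lt_trans (sweep_lt Sp up) _; apply: lt_le_trans (sweep_ge Sq (ltW qv)).
by rewrite -Smono.
Qed.

Lemma sweep_itv t : 0 < t < 1 -> 0 < sweep S t < 1.
Proof.
case/andP=> t0 t1; rewrite (le_lt_trans (sweep_ge0 0)) ?sweep_homo ?(ltW t1) //=.
case: dS => _ _ dn; have [p [Sp /andP[tp _]]] := dn _ _ (ltW t0) t1 (lexx _).
by rewrite (le_lt_trans (sweep_lt Sp tp)) //; case/andP: (S01 Sp).
Qed.
End Sweep.

(** Sweeping the matching forwards and then backwards stays between any two
    matched points that enclose [t], and these are dense. *)
Lemma sweepK S : dense_matching S -> dense_matching (swap S) ->
  forall t, 0 < t < 1 -> sweep (swap S) (sweep S t) = t.
Proof.
move=> dS dS' t /andP[t0 t1]; have [S01 Smono dn] := dS.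
apply/eqP; rewrite eq_le; apply/andP; split.
  apply: sweep_le (ltW t0) _ => -[y x] /= Syx yt.
  rewrite leNgt; apply/negP => tx.
  have x1 : x < 1 by case: dS' => /(_ _ Syx) /= /andP[].
  have [q [Sq /andP[tq qx]]] := dn _ _ (ltW t0) tx (ltW x1).
  have := le_trans yt (sweep_lt dS Sq tq).
  by rewrite leNgt -(Smono _ _ Sq Syx) qx.
rewrite leNgt; apply/negP => lt.
have [p [Sp /andP[p1 p2]]] := dn _ _ (sweep_ge0 dS' _) lt (ltW t1).
have : p.1 <= sweep (swap S) (sweep S t).
  have Sp' : swap S (p.2, p.1) by case: (p) Sp.
  exact: (sweep_ge dS' Sp' (sweep_ge dS Sp (ltW p2))).
by rewrite leNgt p1.
Qed.

Lemma dense_matching_extend S : dense_matching S -> dense_matching (swap S) ->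
  exists H : unit_auto R, forall p, S p -> H p.1 = p.2.
Proof.
move=> dS dS'; have sw : swap (swap S) = S by apply/seteqP; split=> -[].
have [|||H HS] := @unit_auto_ext (sweep S) (sweep (swap S)).
- by move=> t t01; rewrite sweep_itv // sweepK.
- move=> t t01; rewrite sweep_itv //; split=> //.
  by have := sweepK dS'; rewrite sw; exact.
- by move=> s t s0 st t1; apply: (sweep_homo dS); rewrite // ltW.
exists H => p Sp; rewrite HS ?sweep_pair //.
by case: dS' => /(_ (p.2, p.1)) + _ _; apply; case: (p) Sp.
Qed.

(** The points that [F] moves are dense by genericity and form an open set, so
    they contain a rational in every interval.  This makes the enumeration in the
    back-and-forth argument countable. *)
Lemma generic_moved F u v : generic F -> 0 <= u -> u < v -> v <= 1 ->
  exists q : rat, u < ratr q < v /\ F (ratr q) != ratr q.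
Proof.
move=> genF u0 uv v1.
suff [x [y [ux xy yv h]]] : exists x y, [/\ u <= x, x < y, y <= v &
    forall t, x < t < y -> F t != t].
  have [q] := rat_in_itvoo xy; rewrite in_itv /= => xqy; exists q.
  by have /andP[xq qy] := xqy; rewrite (le_lt_trans ux) ?(lt_le_trans qy) ?h.
have [um mv] := midf_lt uv; set m := (u + v) / 2 in um mv.
have [s [/andP[us sv]]] : exists s, u < s < v /\ F s != s.
  have [e|] := eqVneq (F m) m; last by exists m; rewrite um mv.
  have m01 : 0 <= m <= 1 by rewrite (le_trans u0) ?(le_trans _ v1) ?ltW.
  have e0 : 0 < Num.min (m - u) (v - m) by rewrite lt_min !subr_gt0 um.
  have [x [y [z [[cx xy yz zc] [Fx _ _]]]]] := genF m m01 e _ e0.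
  exists x; rewrite gt_eqF //; split=> //; apply/andP; split.
    by apply: le_lt_trans cx; rewrite lerBrDl -lerBrDr ge_min lexx.
  apply: lt_trans xy _; apply: lt_trans yz _.
  by apply: lt_le_trans zc _; rewrite -lerBrDl ge_min lexx orbT.
rewrite neq_lt => /orP[Fs|sF].
- exists (Num.max u (F s)), s; split.
  + by rewrite le_max lexx.
  + by rewrite gt_max us.
  + exact: ltW.
  + move=> t /andP[]; rewrite gt_max => /andP[_ Ft] ts; rewrite lt_eqF //.
    by apply: lt_trans Ft; rewrite ua_lt.
- exists s, (Num.min v (F s)); split.
  + exact: ltW.
  + by rewrite lt_min sv.
  + by rewrite ge_min lexx.
  + move=> t /andP[]; rewrite lt_min => ts /andP[_ tF]; rewrite gt_eqF //.
    by apply: (lt_trans tF); rewrite ua_lt.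
Qed.

(** The back-and-forth argument: rationals are added alternately to the domain and
    to the range, then the orbits of all pairs are matched. *)
Theorem generic_conjugate F G : generic F -> generic G ->
  exists H : unit_auto R, forall t, H (G t) = F (H t).
Proof.
move=> genF genG.
have step1 l r : partial_conj G F l -> exists l', [/\ {subset l <= l'},
    partial_conj G F l' & G r != r -> exists2 a, a \in l' & a.1 = r].
  move=> good; have [e|mv] := eqVneq (G r) r.
    by exists l; split=> //; rewrite e eqxx.
  have [y gy] := partial_conj_extend genF good mv.
  exists ((r, y) :: l); split=> // [a al|_]; first by rewrite inE al orbT.
  by exists (r, y); rewrite ?mem_head.
have step l r : exists l', partial_conj G F l -> [/\ {subset l <= l'},
    partial_conj G F l', G r != r -> exists2 a, a \in l' & a.1 = r &
    F r != r -> exists2 a, a \in l' & a.2 = r].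
  have [good|ngood] := pselect (partial_conj G F l); last by exists l.
  have [l1 [s1 g1 m1]] := step1 l r good.
  have [e|mv] := eqVneq (F r) r; first by exists l1 => _; split=> //; rewrite e eqxx.
  have [x gx] := partial_conj_extend genG (partial_conj_sym g1) mv.
  exists ((x, r) :: l1) => _; split=> [a /s1 al||/m1[a al e]|_].
  - by rewrite inE al orbT.
  - have := partial_conj_sym gx; rewrite /= -map_comp map_id_in //.
    by case.
  - by exists a; rewrite // inE al orbT.
  - by exists (x, r); rewrite ?mem_head.
(* [L n.+1] extends [L n] so as to contain the [n]-th rational in either projection,
   provided that it is a moved point. *)
have [nxt nxtP] := choice (fun lr : seq (R * R) * R => step lr.1 lr.2).
pose r n : R := ratr (odflt 0 (unpickle n)).
pose L := fix L n : seq (R * R) := if n is m.+1 then nxt (L m, r m) else [::].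
have goodL n : partial_conj G F (L n).
  elim: n => [|n IH]; first by split.
  by have [] := nxtP (L n, r n) IH.
have subL n : {subset L n <= L n.+1} by have [] := nxtP (L n, r n) (goodL n).
have {subL} subL m n : (m <= n)%N -> {subset L m <= L n}.
  move=> /subnKC <-; elim: (n - m)%N => [|k IH] a; first by rewrite addn0.
  by move=> /IH /subL; rewrite addnS.
pose S := [set p : R * R | exists a k,
  [/\ exists n, a \in L n, p.1 = zpow G k a.1 & p.2 = zpow F k a.2]].
have Scompat p q : S p -> S q -> (p.1 < q.1) = (p.2 < q.2).
  move=> [a [k [[m am] -> ->]]] [b [k' [[n bn] -> ->]]].
  have [_ cp] := goodL (maxn m n).
  by rewrite cp //; [apply: subL am|apply: subL bn]; rewrite ?leq_maxl ?leq_maxr.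
have Smv a n : a \in L n -> G a.1 != a.1 /\ F a.2 != a.2.
  move=> an; have [mv cp] := goodL n; split; first exact: mv.
  by apply: compat_move (mv _ an); exact: cp.
have S01 p : S p -> (0 < p.1 < 1) /\ (0 < p.2 < 1).
  move=> [a [k [[n /Smv[/ua_moved mG /ua_moved mF]] -> ->]]].
  by rewrite !zpow_itv.
have dS : dense_matching S.
  split=> [p /S01[]//|//|u v u0 uv v1].
  have [q [uqv mv]] := generic_moved genG u0 uv v1.
  have [_ _ hG _] := nxtP (L (pickle q), r (pickle q)) (goodL _).
  have rq : r (pickle q) = ratr q by rewrite /r pickleK.
  have [|a aL e] := hG; first by rewrite /= rq.
  exists a; rewrite e /= rq; split=> //; exists a, 0; split=> //.
  by exists (pickle q).+1.
have dS' : dense_matching (swap S).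
  split=> [p /S01[]//|p q Sp Sq|u v u0 uv v1]; first by rewrite -(Scompat _ _ Sp Sq).
  have [q [uqv mv]] := generic_moved genF u0 uv v1.
  have [_ _ _ hF] := nxtP (L (pickle q), r (pickle q)) (goodL _).
  have rq : r (pickle q) = ratr q by rewrite /r pickleK.
  have [|a aL e] := hF; first by rewrite /= rq.
  exists (a.2, a.1); rewrite /= e /= rq; split=> //; exists a, 0; split=> //.
  - by exists (pickle q).+1.
  - by rewrite /= e rq.
have [H HS] := dense_matching_extend dS dS'.
exists H.
have SGF p : S p -> S (G p.1, F p.2).
  move=> [a [k [aL e1 e2]]]; exists a, (k + 1).
  by rewrite !zpowS e1 e2.
move=> t; apply: (@ua_eq_dense (ua_comp H G) (ua_comp F H)) => u v u0 uv v1.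
have [_ _ dn] := dS; have [p [Sp upv]] := dn u v u0 uv v1.
exists p.1; split=> //=; rewrite (HS p Sp).
exact: (HS _ (SGF p Sp)).
Qed.

(** An increasing bijection carries an above-below-above pattern of [F] to one of
    its conjugate. *)
Lemma generic_conjugation F G H : generic F -> (forall t, H (F t) = G (H t)) ->
  generic G.
Proof.
move=> genF HFG t t01 Gt e e0.
pose V := ua_inv H.
have VG x : F (V x) = V (G x) by rewrite /V -[LHS](uaK H) HFG ua_invK.
have Vt01 : 0 <= V t <= 1 by rewrite (ua_cc (uaV H)).
have FVt : F (V t) = V t by rewrite VG Gt.
have d0 : 0 < Num.min (V t - V (t - e)) (V (t + e) - V t).
  by rewrite lt_min !subr_gt0 !ua_inv_lt ltrBlDr ltrDl e0.
have [x [y [z [[cx xy yz zc] [Fx Fy Fz]]]]] := genF _ Vt01 FVt _ d0.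
exists (H x), (H y), (H z); rewrite !ua_lt -!HFG !ua_lt; split; split=> //.
- rewrite ua_inv_gt; apply: le_lt_trans cx.
  by rewrite lerBrDl -lerBrDr ge_min lexx.
- rewrite ua_lt_inv; apply: lt_le_trans zc _.
  by rewrite -lerBrDl ge_min lexx orbT.
Qed.

End DenseExtension.

(** * Bijections with prescribed values and small support *)

Section Bump.
Context {R : realType}.
Implicit Types (F : unit_auto R) (a b c u v s t x y : R).

(** In the coordinate [(t - u) / (v - t)], which identifies the interval with the
    positive half-line, this is multiplication by [c]. *)
Definition bump c u v t :=
  if u < t < v then (c * (t - u) * v + (v - t) * u) / (c * (t - u) + (v - t)) else t.

Lemma bumpE c u v t : u < t < v ->
  bump c u v t = (c * (t - u) * v + (v - t) * u) / (c * (t - u) + (v - t)).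
Proof. by rewrite /bump => ->. Qed.

Lemma bump_out c u v t : ~~ (u < t < v) -> bump c u v t = t.
Proof. by rewrite /bump => /negPf ->. Qed.

Lemma bump_den c u v t : 0 < c -> u < t < v -> 0 < c * (t - u) + (v - t).
Proof. by move=> c0 /andP[ut tv]; rewrite addr_gt0 ?mulr_gt0 ?subr_gt0. Qed.

Lemma bump_itv c u v t : 0 < c -> u < t < v -> u < bump c u v t < v.
Proof.
move=> c0 utv; have D := bump_den c0 utv; rewrite /bump utv.
case/andP: utv => ut tv; have uv := lt_trans ut tv.
have P1 : 0 < c * (t - u) * (v - u) by rewrite !mulr_gt0 ?subr_gt0.
have P2 : 0 < (v - t) * (v - u) by rewrite mulr_gt0 ?subr_gt0.
by apply/andP; split; rewrite ?ltr_pdivlMr ?ltr_pdivrMr //; lra.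
Qed.

Lemma bumpK c u v : 0 < c -> cancel (bump c u v) (bump c^-1 u v).
Proof.
move=> c0 t; have [utv|utv] := boolP (u < t < v); last by rewrite !bump_out.
rewrite (bumpE _ (bump_itv c0 utv)) (bumpE _ utv).
have D := bump_den c0 utv; have /andP[ut tv] := utv.
have uv := lt_trans ut tv; field.
rewrite !(gt_eqF D, gt_eqF c0) /= [X in X != 0](_ : _ = c * (v - u) ^+ 2); last by ring.
by rewrite gt_eqF // mulr_gt0 ?exprn_gt0 ?subr_gt0.
Qed.

Lemma bump_lt c u v : 0 < c -> {mono bump c u v : s t / s < t}.
Proof.
move=> c0; apply: leW_mono; apply: le_mono => s t st.
have [us|us] := boolP (u < s < v); have [ut|ut] := boolP (u < t < v).
- have Ds := bump_den c0 us; have Dt := bump_den c0 ut.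
  rewrite !bumpE // -subr_gt0.
  have -> : (c * (t - u) * v + (v - t) * u) / (c * (t - u) + (v - t)) -
    (c * (s - u) * v + (v - s) * u) / (c * (s - u) + (v - s)) =
    c * (v - u) ^+ 2 * (t - s) / ((c * (t - u) + (v - t)) * (c * (s - u) + (v - s))).
    by field; rewrite !gt_eqF.
  case/andP: us => us sv.
  by rewrite divr_gt0 ?mulr_gt0 ?exprn_gt0 ?subr_gt0 ?(lt_trans us).
- have /andP[_ h] := bump_itv c0 us; rewrite (bump_out _ ut) (lt_le_trans h) //.
  move: ut; rewrite negb_and -!leNgt => /orP[|//].
  by case/andP: us => us' _; rewrite leNgt (lt_trans us' st).
- have /andP[h _] := bump_itv c0 ut; rewrite (bump_out _ us) (le_lt_trans _ h) //.
  move: us; rewrite negb_and -!leNgt => /orP[//|].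
  by case/andP: ut => _ tv'; rewrite leNgt (lt_trans st tv').
- by rewrite !bump_out.
Qed.

(** The factor is the quotient of the coordinates [(t - u) / (v - t)] of [b] and
    of [a]. *)
Lemma move1 u v a b : 0 <= u -> v <= 1 -> u < a < v -> u < b < v ->
  exists2 phi : unit_auto R, phi a = b & forall t, ~~ (u < t < v) -> phi t = t.
Proof.
move=> u0 v1 a_uv b_uv; pose c := (b - u) * (v - a) / ((v - b) * (a - u)).
have [/andP[ua av] /andP[ub bv]] := (a_uv, b_uv).
have c0 : 0 < c by rewrite divr_gt0 ?mulr_gt0 ?subr_gt0.
have V : cancel (bump c^-1 u v) (bump c u v).
  by have := @bumpK c^-1 u v; rewrite invrK invr_gt0; exact.
have out t : ~~ (0 < t < 1) -> bump c u v t = t.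
  move=> t01; apply: bump_out; apply: contra t01 => /andP[ut tv].
  by rewrite (le_lt_trans u0) ?(lt_le_trans tv).
exists (UnitAuto (bumpK u v c0) V (@bump_lt c u v c0) out); last first.
  by move=> t; exact: bump_out.
rewrite /= (bumpE _ a_uv) /c; field.
rewrite !gt_eqF ?subr_gt0 //= [X in 0 < X](_ : _ = (v - a) * (v - u)); last by ring.
by rewrite mulr_gt0 ?subr_gt0 ?(lt_trans ua).
Qed.

(** The three values are adjusted from left to right; each bump is supported to
    the right of the values already obtained. *)
Lemma move3 u v a1 a2 a3 b1 b2 b3 : 0 <= u -> v <= 1 ->
  [/\ u < a1, a1 < a2, a2 < a3 & a3 < v] -> [/\ u < b1, b1 < b2, b2 < b3 & b3 < v] ->
  exists phi : unit_auto R, [/\ phi a1 = b1, phi a2 = b2, phi a3 = b3 &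
    forall t, ~~ (u < t < v) -> phi t = t].
Proof.
move=> u0 v1 [ua1 a12 a23 a3v] [ub1 b12 b23 b3v].
have b2v := lt_trans b23 b3v; have b1v := lt_trans b12 b2v.
have ub2 := lt_trans ub1 b12.
have [||f fa1 fout] := @move1 u v a1 b1 u0 v1.
- by rewrite ua1 (lt_trans a12) // (lt_trans a23).
- by rewrite ub1.
have fv : f v = v by rewrite fout // ltxx andbF.
have [||g ga2 gout] := @move1 b1 v (f a2) b2 (le_trans u0 (ltW ub1)) v1.
- by rewrite -{1}fa1 -fv !ua_lt a12 (lt_trans a23).
- by rewrite b12.
have gv : g v = v by rewrite gout // ltxx andbF.
have gb1 : g b1 = b1 by rewrite gout // ltxx.
have [||h ha3 hout] := @move1 b2 v (g (f a3)) b3 (le_trans u0 (ltW ub2)) v1.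
- by rewrite -{1}ga2 -gv -fv !ua_lt a23.
- by rewrite b23.
exists (ua_comp h (ua_comp g f)); split=> /=.
- by rewrite fa1 gb1 hout // ltNge (ltW b12).
- by rewrite ga2 hout // ltxx.
- exact: ha3.
- move=> t tuv; rewrite (fout t) // (gout t) ?hout //.
  + by apply: contra tuv => /andP[/(lt_trans ub2) -> ->].
  + by apply: contra tuv => /andP[/(lt_trans ub1) -> ->].
Qed.

Lemma ua_continuous F : {within `[0, 1], continuous F}.
Proof.
apply: segment_inc_surj_continuous => [x y _ _|y]; first exact: ua_le.
rewrite ua0 ua1 /= => y01; exists (ua_inv F y); rewrite ?ua_invK //=.
by move: y01; rewrite !in_itv /= (ua_cc (uaV F)).
Qed.

End Bump.

(** * Baire's theorem for the space of homeomorphisms *)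

Section MetricBaire.
Context {R : realType}.

(** The inequalities are non-strict because these pass to limits. *)
Definition metric_complete (M : metricType R) := forall u : nat -> M,
  (forall e : R, 0 < e -> exists N, forall m n, (N <= m)%N -> (N <= n)%N ->
     mdist (u m) (u n) <= e) ->
  exists l, forall e : R, 0 < e -> exists N, forall n, (N <= n)%N -> mdist (u n) l <= e.

Lemma metric_openP (M : metricType R) (U : set M) : open U <->
  forall x, U x -> exists2 d : R, 0 < d & forall y, mdist x y < d -> U y.
Proof.
rewrite openE; split=> oU x Ux; have := oU x Ux;
  rewrite /interior /= -metricType_numDomainType.filter_from_mdist_nbhs;
  by move=> [d d0 dU]; exists d => // y xy; apply: dU.
Qed.

Lemma metric_ball_open (M : metricType R) (x : M) (d : R) : open (ball x d).
Proof.
apply/metric_openP => y; rewrite ballEmdist /= => xy.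
exists (d - mdist x y); first by rewrite subr_gt0.
by move=> z yz; apply: le_lt_trans (metric_triangle _ y _) _; rewrite -ltrBrDl.
Qed.

(** Nested closed balls, each inside the next open set and with at most half the
    radius of the previous one. *)
Theorem metric_Baire (M : metricType R) (U : nat -> set M) : metric_complete M ->
  (forall i, open (U i)) -> (forall i, dense (U i)) -> dense (\bigcap_i U i).
Proof.
move=> cM oU dU O [x0 Ox0] oO.
have step i (fr : M * R) : exists gs : M * R, 0 < fr.2 ->
    [/\ 0 < gs.2, gs.2 <= fr.2 / 2 &
      forall h, mdist gs.1 h <= gs.2 -> U i h /\ mdist fr.1 h < fr.2].
  have [r0|nr0] := pselect (0 < fr.2); last by exists fr.
  have [|g [Bg Ug]] := dU i (ball fr.1 fr.2 : set M) _ (@metric_ball_open _ _ _).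
    by exists fr.1; exact: ballxx.
  have [d d0 dP] := (metric_openP _).1
    (openI (@metric_ball_open _ fr.1 fr.2) (oU i)) g (conj Bg Ug).
  exists (g, Num.min (d / 2) (fr.2 / 2)) => _; rewrite /= lt_min !divr_gt0 //.
  rewrite ge_min lexx orbT; split=> // h; rewrite le_min => /andP[gh _].
  have [|+ Uh] := dP h.
    by rewrite (le_lt_trans gh) // ltr_pdivrMr // ltr_pMr // ltr1n.
  by rewrite ballEmdist.
have [nxt nxtP] := choice (fun ifr : nat * (M * R) => step ifr.1 ifr.2).
have [r0 r00 r0P] := (metric_openP _).1 oO x0 Ox0.
pose B := fix B n : M * R := if n is m.+1 then nxt (m, B m) else (x0, r0 / 2).
have B0 n : 0 < (B n).2.
  by elim: n => [|n IH] /=; [rewrite divr_gt0|have [] := nxtP (n, B n) IH].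
have Bhalf n : (B n.+1).2 <= (B n).2 / 2 by have [] := nxtP (n, B n) (B0 n).
have Bnest n h : mdist (B n.+1).1 h <= (B n.+1).2 -> U n h /\ mdist (B n).1 h < (B n).2.
  by have [_ _] := nxtP (n, B n) (B0 n); apply.
have Bsub n k h : mdist (B (n + k)%N).1 h <= (B (n + k)%N).2 ->
    mdist (B n).1 h <= (B n).2.
  elim: k h => [|k IH] h; first by rewrite addn0.
  by rewrite addnS => /Bnest[_ /ltW /IH].
have Bdist n m : (n <= m)%N -> mdist (B n).1 (B m).1 <= (B n).2.
  move=> /subnKC <-; apply: (@Bsub n (m - n)%N); rewrite mdistxx ltW //.
have Bsmall (e : R) : 0 < e -> exists n, (B n).2 + (B n).2 <= e.
  move=> e0; have Bn n : (B n).2 * (n.+1)%:R <= r0.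
    elim: n => [|n IH]; first by rewrite mulr1 /= ler_pdivrMr // ler_pMr // ler1n.
    apply: le_trans IH; have := Bhalf n; have := B0 n.
    rewrite -[n.+2%:R]natr1 -[n.+1%:R]natr1; have : 0 <= n%:R :> R by [].
    move: (B n).2 (B n.+1).2 (n%:R : R) => b b' x xge0 b0 bb'.
    have x2 : 0 <= x + 1 + 1 by lra.
    have := ler_wpM2r x2 bb'; have := mulr_ge0 (ltW b0) xge0; lra.
  exists (Num.truncn (2 * r0 / e)); set n := Num.truncn _.
  have : 2 * r0 / e < n.+1%:R by exact: truncnS_gt.
  rewrite ltr_pdivrMr // => h; have Bnn := Bn n.
  have n0 : 0 < n.+1%:R :> R by rewrite ltr0n.
  rewrite -(ler_pM2r n0); lra.
have [|l lP] := cM (fun n => (B n).1).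
  move=> e e0; have [N NP] := Bsmall e e0; exists N => m n Nm Nn.
  apply: le_trans (metric_triangle _ (B N).1 _) _; apply: le_trans NP.
  by rewrite lerD ?Bdist // metric_sym Bdist.
have Bl n : mdist (B n).1 l <= (B n).2.
  apply/ler_addgt0Pr => e e0; have [N NP] := lP e e0.
  apply: le_trans (metric_triangle _ (B (maxn n N)).1 _) _.
  by rewrite lerD ?Bdist ?NP ?leq_maxl ?leq_maxr.
exists l; split; last by move=> n _; have [] := Bnest n l (Bl n.+1).
apply: r0P; apply: le_lt_trans (Bl 0%N) _.
by rewrite /= ltr_pdivrMr // ltr_pMr // ltr1n.
Qed.

End MetricBaire.

Section HomeoComplete.
Context {R : realType} {X : metricType R} (cX : compact [set: X]).

(** Any cluster point of the sequence serves as [l]. *)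
Lemma compact_tail_limit (x : nat -> X) : exists l, forall (e : R) N,
  (forall m n, (N <= m)%N -> (N <= n)%N -> mdist (x m) (x n) <= e) ->
  forall n, (N <= n)%N -> mdist (x n) l <= e.
Proof.
have [l [_ cl]] : [set: X] `&` cluster (x @ \oo) !=set0.
  by apply: cX; exact: filterT.
exists l => e N xP n Nn; apply/ler_addgt0Pr => d d0.
have [|_ [[m /= Nm <-]]] := cl [set x m | m in [set m | (N <= m)%N]]
  (ball l d) _ (nbhsx_ballx _ _ d0).
  by exists N => // m Nm; exists m.
rewrite ballEmdist /= => lm.
apply: le_trans (metric_triangle _ (x m) _) _.
by rewrite lerD ?xP // metric_sym ltW.
Qed.

Lemma continuous_mdist (f : X -> X) : continuous f <->
  forall x (e : R), 0 < e ->
    exists2 d, 0 < d & forall y, mdist x y < d -> mdist (f x) (f y) < e.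
Proof.
split=> [cf x e e0|cf x].
  have := cf x; move=> /metricType_numDomainType.cvgrPdist_lt /(_ e e0).
  move=> /nbhs_ballP[d d0 dP].
  by exists d => // y xy; apply: dP; rewrite ballEmdist.
apply/metricType_numDomainType.cvgrPdist_lt => e e0; apply/nbhs_ballP.
by have [d d0 dP] := cf x e e0; exists d => // y; rewrite ballEmdist; exact: dP.
Qed.

Definition uniform_tail (u : nat -> X -> X) (f : X -> X) :=
  forall e : R, 0 < e ->
    exists N, forall n, (N <= n)%N -> forall x, mdist (u n x) (f x) <= e.

Lemma uniform_tail_continuous u f : uniform_tail u f -> (forall n, continuous (u n)) ->
  continuous f.
Proof.
move=> uf cu; apply/continuous_mdist => x e e0.
have e3 : 0 < e / 3 by rewrite divr_gt0.
have [N /(_ N (leqnn N)) NP] := uf _ e3.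
have /continuous_mdist/(_ x _ e3)[d d0 dP] := cu N.
exists d => // y xy.
have h1 := NP x; have h2 := NP y; have h3 := dP y xy.
have h4 := metric_triangle (f x) (u N x) (f y).
have h5 := metric_triangle (u N x) (u N y) (f y).
rewrite [mdist (f x) (u N x)]metric_sym in h4; lra.
Qed.

(** [u n x] is close to [f x] for large [n], so [g (u n x)] is close to [g (f x)] by
    continuity of [g], and to [v n (u n x) = x] by uniform convergence. *)
Lemma uniform_tail_cancel u v f g : uniform_tail u f -> uniform_tail v g ->
  continuous g -> (forall n, cancel (u n) (v n)) -> cancel f g.
Proof.
move=> uf vg cg uv x; apply: mdist_positivity; apply/eqP.
rewrite eq_le mdist_ge0 andbT; apply/ler_addgt0Pr => e e0; rewrite add0r.
have e2 : 0 < e / 2 by rewrite divr_gt0.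
have /continuous_mdist/(_ (f x) _ e2)[d d0 dP] := cg.
have d2 : 0 < d / 2 by rewrite divr_gt0.
have [N1 P1] := uf _ d2; have [N2 P2] := vg _ e2.
have h1 := P1 _ (leq_maxl N1 N2) x.
have h2 := P2 _ (leq_maxr N1 N2) (u (maxn N1 N2) x).
rewrite uv in h2; rewrite metric_sym in h1.
have h3 : mdist (f x) (u (maxn N1 N2) x) < d by lra.
have := dP _ h3; have := metric_triangle (g (f x)) (g (u (maxn N1 N2) x)) x.
rewrite metric_sym in h2; lra.
Qed.

(** The C0 distance controls the inverses as well, so both they and the maps
    converge uniformly, to continuous maps that remain inverse to each other. *)
Lemma homeo_complete : metric_complete (homeo cX).
Proof.
move=> u uC.
have lim (v : nat -> X -> X) : 
    (forall m n x, mdist (v m x) (v n x) <= mdist (u m) (u n)) ->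
    exists f, forall (e : R) N,
      (forall m n, (N <= m)%N -> (N <= n)%N -> mdist (u m) (u n) <= e) ->
      forall n, (N <= n)%N -> forall x, mdist (v n x) (f x) <= e.
  move=> vu; have [f fP] := choice (fun x => compact_tail_limit (v^~ x)).
  exists f => e N uN n Nn x; apply: (fP x e N) => // m m' Nm Nm'.
  exact: le_trans (vu _ _ _) (uN _ _ Nm Nm').
have [f fP] := lim (fun n => u n) (fun m n x => C0dist_ub _ _ _).
have [g gP] := lim (fun n => homeo_inv (u n)) (fun m n x => C0dist_inv_ub _ _ _).
have uf : uniform_tail (fun n => u n) f.
  by move=> e /uC[N NP]; exists N; exact: fP.
have ug : uniform_tail (fun n => homeo_inv (u n)) g.
  by move=> e /uC[N NP]; exists N; exact: gP.
have cf : continuous f.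
  by apply: uniform_tail_continuous uf _ => n; exact: homeo_continuous.
have cg : continuous g.
  by apply: uniform_tail_continuous ug _ => n; exact: homeo_inv_continuous.
have fg : cancel f g by apply: uniform_tail_cancel uf ug cg _ => n; exact: homeoK.
have gf : cancel g f by apply: uniform_tail_cancel ug uf cf _ => n; exact: homeo_invK.
exists (Homeo cX cf cg fg gf) => e e0; have [N NP] := uC e e0; exists N => n Nn.
apply: C0dist_le => [|x|x]; first exact: ltW.
- exact: fP NP _ Nn x.
- exact: gP NP _ Nn x.
Qed.

Lemma comp_continuous (u v : X -> X) :
  continuous u -> continuous v -> continuous (u \o v).
Proof. by move=> cu cv x; exact: continuous_comp (cv x) (cu (v x)). Qed.

Definition homeo_comp (f f' : homeo cX) : homeo cX :=
  Homeo cX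
    (comp_continuous (@homeo_continuous _ _ _ f) (@homeo_continuous _ _ _ f'))
    (comp_continuous (@homeo_inv_continuous _ _ _ f')
       (@homeo_inv_continuous _ _ _ f))
    (can_comp (@homeoK _ _ _ f) (@homeoK _ _ _ f'))
    (can_comp (@homeo_invK _ _ _ f') (@homeo_invK _ _ _ f)).

End HomeoComplete.

(** * A single arc *)

Section Within.
Context {T U V : topologicalType}.

Lemma within_comp (A : set T) (B : set U) (f : T -> U) (g : U -> V) :
  {within A, continuous f} -> {within B, continuous g} -> f @` A `<=` B ->
  {within A, continuous (g \o f)}.
Proof.
move=> /subspace_continuousP cf /subspace_continuousP cg fAB.
apply/subspace_continuousP => x Ax W nW.
have Bfx : B (f x) by apply: fAB; exists x.
have := cf x Ax _ (cg (f x) Bfx W nW).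
rewrite /nbhs /= /within /=; apply: filterS => y hy Ay.
by apply: hy => //; apply: fAB; exists y.
Qed.

Lemma within_eq (A : set T) (f g : T -> U) : {within A, continuous f} ->
  (forall x, A x -> f x = g x) -> {within A, continuous g}.
Proof.
move=> /subspace_continuousP cf fg; apply/subspace_continuousP => x Ax W nW.
have nW' : nbhs (f x) W by rewrite fg.
have := cf x Ax W nW'.
rewrite /nbhs /= /within /=; apply: filterS => y hy Ay.
by rewrite /from_subspace -fg //; exact: hy.
Qed.

Lemma within_open_continuous (A O : set T) (f : T -> U) x : {within A, continuous f} ->
  open O -> O `<=` A -> O x -> {for x, continuous f}.
Proof.
move=> /subspace_continuousP cf oO OA Ox W nW.
have h : nbhs x (fun y => A y -> W (f y)) := cf x (OA _ Ox) W nW.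
have nO : nbhs x O by apply: open_nbhs_nbhs.
by apply: filterS (filterI nO h) => y [Oy hy]; apply: hy; exact: OA.
Qed.

End Within.

Section Arc.
Context {R : realType} {X : metricType R}.
Context (A : set X) (h : R -> X) (g : X -> R).
Hypothesis hg : homeomorphism_on (`[0, 1] : set R) A h g.

Lemma arc_in t : 0 <= t <= 1 -> A (h t).
Proof.
by case: hg => _ + _ _ _ => hA t01; apply: hA; exists t => //=; rewrite in_itv.
Qed.

Lemma arc_coord x : A x -> 0 <= g x <= 1.
Proof.
by case: hg => _ _ + _ _ => gA Ax; have : (`[0, 1]%classic : set R) (g x);
  [apply: gA; exists x|rewrite /= in_itv].
Qed.

Lemma arcK t : 0 <= t <= 1 -> g (h t) = t.
Proof. by case: hg => _ _ _ + _ => hK t01; apply: hK; rewrite inE /= in_itv. Qed.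

Lemma arc_invK x : A x -> h (g x) = x.
Proof. by case: hg => _ _ _ _ + => gK Ax; apply: gK; rewrite inE. Qed.

Lemma arc_cont : {within `[0, 1], continuous h}. Proof. by case: hg => -[]. Qed.
Lemma arc_inv_cont : {within A, continuous g}. Proof. by case: hg => -[]. Qed.

Lemma arcE : A = h @` (`[0, 1]).
Proof.
apply/seteqP; split=> [x Ax|_ [t t01 <-]].
  by exists (g x); rewrite ?arc_invK //= in_itv arc_coord.
by apply: arc_in; move: t01; rewrite /= in_itv.
Qed.

Lemma arc_compact : compact A.
Proof.
by rewrite arcE; apply: continuous_compact arc_cont _; exact: segment_compact.
Qed.

Lemma arc_closed : closed A.
Proof. by apply: compact_closed arc_compact; exact: metric_hausdorff. Qed.

Lemma arc_connected : connected A.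
Proof.
rewrite arcE; apply: connected_continuous_connected arc_cont.
exact: segment_connected.
Qed.

Lemma arc_interior x : (A `\` [set h 0; h 1]) x <-> exists2 t, 0 < t < 1 & x = h t.
Proof.
split=> [[Ax /not_orP[x0 x1]]|[t t01 ->]].
  exists (g x); last by rewrite arc_invK.
  have /andP[g0 g1] := arc_coord Ax; rewrite !lt_neqAle g0 g1 !andbT.
  apply/andP; split; apply/eqP => e; [apply: x0|apply: x1]; rewrite -(arc_invK Ax) /=;
  by rewrite ?e // -e.
have t01' : 0 <= t <= 1 by case/andP: t01 => t0 t1; rewrite !ltW.
split; first exact: arc_in.
by case=> /= e; move: t01; rewrite -(arcK t01') e arcK ?lexx ?ler01 // ltxx ?andbF.
Qed.

Lemma arc_interiorE : A `\` [set h 0; h 1] = h @` (`]0, 1[).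
Proof.
apply/seteqP; split=> [x /arc_interior[t t01 ->]|_ [t t01 <-]].
  by exists t => //=; rewrite in_itv.
by apply/arc_interior; exists t => //; move: t01; rewrite /= in_itv.
Qed.

Lemma arc_interior_connected : connected (A `\` [set h 0; h 1]).
Proof.
rewrite arc_interiorE; apply: connected_continuous_connected.
  exact/connected_intervalP/interval_is_interval.
apply: continuous_subspaceW arc_cont.
by apply: subset_itvW.
Qed.

Lemma arc_dist t (e : R) : 0 <= t <= 1 -> 0 < e -> exists2 d, 0 < d &
  forall s, 0 <= s <= 1 -> `|t - s| < d -> mdist (h t) (h s) < e.
Proof.
move=> t01 e0; have /subspace_continuousP/(_ t) := arc_cont.
rewrite /= in_itv => /(_ t01)/metricType_numDomainType.cvgrPdist_lt/(_ e e0).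
rewrite near_withinE => /nbhs_ballP[d d0 dP]; exists d => // s s01 ts.
by apply: dP => //=; rewrite in_itv.
Qed.

(** The interior of an arc is dense in the arc. *)
Lemma arc_sub_closed (B : set X) : closed B -> A `\` [set h 0; h 1] `<=` B -> A `<=` B.
Proof.
move=> cB intB x Ax; rewrite -(arc_invK Ax); have t01 := arc_coord Ax.
move: (g x) t01 => t t01; apply: cB => W /nbhs_ballP[e e0 eW].
have [d d0 dP] := arc_dist t01 e0.
pose m := Num.min (1 / 2) d; have m0 : 0 < m by rewrite lt_min d0 divr_gt0.
have m12 : m <= 1 / 2 by rewrite ge_min lexx.
have md : m <= d by rewrite ge_min lexx orbT.
pose s := t + m * (1 / 2 - t).
have /andP[t0 t1] := t01.
have s01 : 0 < s < 1.
  rewrite /s; apply/andP; split; nra.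
have /andP[/ltW s0 /ltW s1] := s01.
exists (h s); split; first by apply/intB/arc_interior; exists s.
apply: eW; rewrite ballEmdist; apply: dP; first by rewrite s0.
rewrite /s opprD addNKr normrN normrM gtr0_norm //.
have : `|1 / 2 - t| < 1 by rewrite ltr_norml; lra.
rewrite -(ltr_pM2l m0) mulr1 => /lt_le_trans; exact.
Qed.

Variable phi : unit_auto R.

(** An increasing bijection of the unit interval acts on the arc through the
    parametrization; when the interior of the arc is open, the identity outside
    the arc extends this action continuously. *)
Definition arc_act x := if x \in A then h (phi (g x)) else x.

Lemma arc_act_continuous : open (A `\` [set h 0; h 1]) -> continuous arc_act.
Proof.
move=> oU; apply/continuous_subspace_setT.
rewrite (_ : [set: X] = A `|` ~` (A `\` [set h 0; h 1])); last first.
  by apply/seteqP; split=> // x _; have [Ax|nAx] := pselect (A x); [left|right=> -[]].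
apply: withinU_continuous; [exact: arc_closed|exact: open_closedC|..].
  apply: (@within_eq _ _ _ (h \o (phi \o g))).
    apply: (within_comp _ arc_cont); last first.
      by move=> _ [x Ax <-] /=; rewrite in_itv /= ua_cc; exact: arc_coord.
    apply: (within_comp arc_inv_cont (@ua_continuous _ phi)).
    by move=> _ [x Ax <-] /=; rewrite in_itv /= arc_coord.
  by move=> x Ax; rewrite /arc_act mem_set.
apply: (@within_eq _ _ _ id); first by apply: continuous_subspaceT => y; exact: cvg_id.
move=> x nUx; rewrite /arc_act; case: ifPn => // /set_mem Ax.
have [->|->] : x = h 0 \/ x = h 1.
  apply: contrapT => n; by apply: nUx; split.
- by rewrite arcK ?ua0 // lexx ler01.
- by rewrite arcK ?ua1 // lexx ler01.
Qed.

End Arc.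

Section ArcHomeo.
Context {R : realType} {X : metricType R} (cX : compact [set: X]).
Context (A : set X) (h : R -> X) (g : X -> R).
Hypothesis hg : homeomorphism_on (`[0, 1] : set R) A h g.

Lemma arc_inj s t : 0 <= s <= 1 -> 0 <= t <= 1 -> h s = h t -> s = t.
Proof. by move=> s01 t01 e; rewrite -(arcK hg s01) e (arcK hg). Qed.

Lemma arc_actE phi x : A x -> arc_act A h g phi x = h (phi (g x)).
Proof. by move=> Ax; rewrite /arc_act mem_set. Qed.

Lemma arc_act_out phi x : ~ A x -> arc_act A h g phi x = x.
Proof. by move=> Ax; rewrite /arc_act memNset. Qed.

Lemma arc_actK phi : cancel (arc_act A h g phi) (arc_act A h g (uaV phi)).
Proof.
move=> x; have [Ax|nAx] := pselect (A x); last by rewrite !arc_act_out.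
have g01 : 0 <= phi (g x) <= 1 by rewrite ua_cc (arc_coord hg).
rewrite (arc_actE phi Ax) arc_actE; last exact: (arc_in hg).
by rewrite (arcK hg) //= uaK (arc_invK hg).
Qed.

Lemma arc_act_invK phi : cancel (arc_act A h g (uaV phi)) (arc_act A h g phi).
Proof.
move=> x; have [Ax|nAx] := pselect (A x); last by rewrite !arc_act_out.
have g01 : 0 <= uaV phi (g x) <= 1 by rewrite ua_cc (arc_coord hg).
rewrite (arc_actE (uaV phi) Ax) arc_actE; last exact: (arc_in hg).
by rewrite (arcK hg) //= ua_invK (arc_invK hg).
Qed.

Definition arc_homeo (oU : open (A `\` [set h 0; h 1])) phi : homeo cX :=
  Homeo cX (arc_act_continuous hg (phi := phi) oU)
    (arc_act_continuous hg (phi := uaV phi) oU) (arc_actK phi) (arc_act_invK phi).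

Variable f : homeo cX.
Hypothesis fA : f @` A = A.
Hypothesis f0 : f (h 0) = h 0.
Hypothesis f1 : f (h 1) = h 1.

Lemma arc_stable x : A (f x) <-> A x.
Proof.
split=> [|Ax]; last by rewrite -fA; exists x.
by rewrite -{1}fA => -[y Ay /(can_inj (@homeoK _ _ _ f)) <-].
Qed.

(** Read in the parametrization, [f] is a continuous injection of the unit interval
    that fixes both ends, hence increasing. *)
Lemma arc_chart_exists : exists F : unit_auto R,
  forall t, 0 <= t <= 1 -> h (F t) = f (h t).
Proof.
pose phi t := g (f (h t)); pose psi t := g (homeo_inv f (h t)).
have w (t : R) : 0 < t < 1 -> 0 <= t <= 1 by case/andP=> t0 t1; rewrite !ltW.
have w0 : 0 <= (0 : R) <= 1 by rewrite lexx ler01.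
have w1 : 0 <= (1 : R) <= 1 by rewrite lexx ler01.
have Af t : 0 <= t <= 1 -> A (f (h t)) by move=> t01; apply/arc_stable/(arc_in hg).
have Af' t : 0 <= t <= 1 -> A (homeo_inv f (h t)).
  by move=> t01; apply/arc_stable; rewrite homeo_invK; exact: (arc_in hg).
have phi01 t : 0 <= t <= 1 -> 0 <= phi t <= 1 by move=> /Af/(arc_coord hg).
have psi01 t : 0 <= t <= 1 -> 0 <= psi t <= 1 by move=> /Af'/(arc_coord hg).
have phiK t : 0 <= t <= 1 -> psi (phi t) = t.
  move=> t01; rewrite /psi /phi (arc_invK hg); last exact: Af.
  by rewrite homeoK (arcK hg).
have psiK t : 0 <= t <= 1 -> phi (psi t) = t.
  move=> t01; rewrite /psi /phi (arc_invK hg); last exact: Af'.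
  by rewrite homeo_invK (arcK hg).
have phi0 : phi 0 = 0 by rewrite /phi f0 (arcK hg).
have phi1 : phi 1 = 1 by rewrite /phi f1 (arcK hg).
have cphi : {within `[0, 1], continuous phi}.
  apply: (@within_comp _ _ _ _ A (f \o h) g) (arc_inv_cont hg) _; last first.
    by move=> _ [t t01 <-]; apply: Af; move: t01; rewrite /= in_itv.
  apply: (@within_comp _ _ _ _ setT) (arc_cont hg) _ _ => //.
  by have /continuous_subspace_setT := @homeo_continuous _ _ _ f.
have phi_le : {in `[0, 1] &, {mono phi : x y / x <= y}}.
  apply: segment_continuous_inj_le => //; first by rewrite phi0 phi1 ler01.
  move=> s t; rewrite !in_itv /= => s01 t01 e.
  by rewrite -(phiK s) // e phiK.
have phi_lt s t : 0 <= s <= 1 -> 0 <= t <= 1 -> (phi s < phi t) = (s < t).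
  by move=> s01 t01; rewrite !ltNge phi_le ?in_itv.
have [|||F FE] := @unit_auto_ext _ phi psi.
- move=> t t01; split; last exact/phiK/w.
  by rewrite -{1}phi0 -[X in phi t < X]phi1 !phi_lt // w.
- move=> t t01; split; last exact/psiK/w.
  have p01 := psi01 t (w t t01).
  by rewrite -(phi_lt 0) // -(phi_lt _ 1) // phi0 phi1 psiK // w.
- move=> s t s0 st t1; rewrite phi_lt //; apply: w; first by rewrite s0 (lt_trans st).
  by rewrite t1 (lt_trans s0).
exists F => t t01; have [tt|] := boolP (0 < t < 1).
  by rewrite FE // /phi (arc_invK hg) //; exact: Af.
move=> nt; rewrite (ua_out F) //.
have [->|->] : t = 0 \/ t = 1.
  move: nt t01; rewrite negb_and -!leNgt => /orP[] h1 /andP[t0 t1]; [left|right];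
  by apply/eqP; rewrite eq_le ?h1 ?t0 ?t1.
- by rewrite f0.
- by rewrite f1.
Qed.

End ArcHomeo.

(** * A rigid family of arcs *)

(** A countable set has Lebesgue measure zero, an interval does not. *)
Lemma avoid_countable (R : realType) (I : countType) (d : I -> R) (e : R) : 0 < e ->
  exists r, 0 < r < e /\ forall i, d i != r.
Proof.
move=> e0; apply: contrapT => H.
have sub : `]0, e[ `<=` range d.
  move=> r; rewrite /= in_itv /= => re; apply: contrapT => nr; apply: H; exists r.
  by split=> // i; apply/eqP => dr; apply: nr; exists i.
have cnt : countable (`]0, e[ : set R).
  apply: sub_countable (subset_card_le sub) _.
  by apply: sub_countable (card_image_le _ _) (countableP _).
have := countable_lebesgue_measure0 cnt; rewrite lebesgue_measure_itv /= lte_fin e0.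
by rewrite sube0 => -[] /eqP; rewrite gt_eqF.
Qed.

Section Family.
Context {R : realType} {X : metricType R} (cX : compact [set: X]).
Context (a : nat -> set X) (h : nat -> R -> X) (g : nat -> X -> R).
Hypothesis hg : forall n, homeomorphism_on (`[0, 1] : set R) (a n) (h n) (g n).
Hypothesis cover : forall x, exists n, a n x.
Local Notation U n := (a n `\` [set h n 0; h n 1]).
Hypothesis oU : forall n, open (U n).
Hypothesis rigid : forall (f : homeo cX) n,
  [/\ f @` a n = a n, f (h n 0) = h n 0 & f (h n 1) = h n 1].

Definition endpoint (i : nat * bool) : X := h i.1 (if i.2 then 1 else 0).

Lemma endpoint_fixed (f : homeo cX) i : f (endpoint i) = endpoint i.
Proof. by case: i => n b; have [_ f0 f1] := rigid f n; case: b. Qed.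

(** A homeomorphism supported in the interior of an arc can move any point of this
    interior, whereas it fixes the ends of all arcs. *)
Lemma endpoint_interior i n : ~ U n (endpoint i).
Proof.
move=> /(arc_interior (hg n))[t t01 e].
have /andP[t0 t1] := t01.
have t01' : 0 <= t <= 1 by rewrite !ltW.
have s01 : 0 < t / 2 < 1 by apply/andP; split; lra.
have s01' : 0 <= t / 2 <= 1 by apply/andP; split; lra.
have [phi phit _] := @move1 R 0 1 t (t / 2) (lexx 0) (lexx 1) t01 s01.
have := endpoint_fixed (arc_homeo cX (hg n) (oU n) phi) i.
rewrite e /= arc_actE; last exact: (arc_in (hg n)).
rewrite (arcK (hg n)) // phit => /(arc_inj (hg n)) H.
have := H s01' t01'; lra.
Qed.

Lemma interior_or_end n x : a n x -> U n x \/ exists i, x = endpoint i.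
Proof.
move=> Ax; have [Ux|nUx] := pselect (U n x); [by left|right].
have [->|->] : x = h n 0 \/ x = h n 1 by apply: contrapT => H; apply: nUx.
- by exists (n, false).
- by exists (n, true).
Qed.

Lemma endpoint_cases n i : a n (endpoint i) ->
  endpoint i = h n 0 \/ endpoint i = h n 1.
Proof.
by move=> Ae; apply: contrapT => H; apply: (@endpoint_interior i n); split.
Qed.

(** The part of the interior of [a n] that lies in the closed arc [a m] is also
    open, because no end of [a m] lies in an interior; connectedness applies. *)
Lemma overlap_sub n m x : U n x -> U m x -> a n `<=` a m.
Proof.
move=> nx mx; apply: (arc_sub_closed (hg n)) (arc_closed (hg m)) _.
suff <- : U n `&` U m = U n by move=> y [_ []].
apply: (arc_interior_connected (hg n)).
- by exists x.
- by exists (U m).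
- exists (a m); first exact: (arc_closed (hg m)).
  apply/seteqP; split=> y [Uy]; first by case.
  by move=> /interior_or_end[|[i e]]; [|rewrite e in Uy; case: (endpoint_interior Uy)].
Qed.

Lemma overlap_eq n m x : U n x -> a m x -> a n = a m.
Proof.
move=> nx /interior_or_end[mx|[i e]]; last first.
  by rewrite e in nx; case: (endpoint_interior nx).
by apply/seteqP; split; [exact: overlap_sub nx mx|exact: overlap_sub mx nx].
Qed.

(** Continuity at an end [x], where infinitely many arcs may accumulate, rests on a
    sphere around [x] that contains no end of an arc. *)
Lemma glue_continuous (k : X -> X) : (forall n, {within a n, continuous k}) ->
  (forall n, k @` a n `<=` a n) -> (forall i, k (endpoint i) = endpoint i) ->
  continuous k.
Proof.
move=> ck ka ke x.
have [n Ax] := cover x; have [Ux|[i xe]] := interior_or_end Ax.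
  have sub : U n `<=` a n by move=> y [].
  exact: (within_open_continuous (ck n) (oU n) sub Ux).
apply/metricType_numDomainType.cvgrPdist_lt => e e0; apply/nbhs_ballP.
have kx : k x = x by rewrite xe ke.
(* The sphere [S] of radius [r] lies in the union of the open interiors. *)
have [r [/andP[r0 re] rP]] := avoid_countable (fun i => mdist x (endpoint i)) e0.
pose S := [set y | mdist x y = r].
have mc : continuous (fun y => mdist x y).
  move=> y; apply/cvgrPdist_lt => s s0; apply/nbhs_ballP; exists s => // z.
  rewrite ballEmdist /= => yz; apply: le_lt_trans yz.
  rewrite ler_norml lerBlDr lerBrDr.
  have h1 := metric_triangle x z y; have h2 := metric_triangle x y z.
  rewrite [mdist z y]metric_sym in h1; lra.
have cS : compact S.
  apply: (subclosed_compact _ cX) => //.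
  exact: ((continuous_closedP _).1 mc _ (@closed_eq _ r)).
have [N NP] : exists N, forall y, S y -> exists2 m, (m < N)%N & U m y.
  have /compact_near_coveringP/(_ nat \oo
    (fun N y => exists2 m, (m < N)%N & U m y)) := cS.
  case=> [y Sy|N _ /(_ N (leqnn N)) NP]; last by exists N.
  have [m Am] := cover y.
  have Um : U m y.
    have [//|[j e']] := interior_or_end Am.
    by have := rP j; rewrite -e' => /eqP.
  exists (U m, [set N | (m < N)%N]); last by case=> z N [/= Uz mN]; exists m.
  split; first by apply: open_nbhs_nbhs; split; [exact: oU|exact: Um].
  by exists m.+1.
have [d [d0 dP]] : exists d, 0 < d /\ forall m y, (m < N)%N -> a m y ->
    mdist x y < d -> mdist x (k y) < e.
  elim: N {NP} => [|N [d [d0 dP]]]; first by exists 1.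
  suff [d' d'0 d'P] : exists2 d', 0 < d' & forall y, a N y ->
      mdist x y < d' -> mdist x (k y) < e.
    exists (Num.min d d'); rewrite lt_min d0; split=> // m y.
    rewrite ltnS leq_eqVlt => /orP[/eqP->|mN] Ay; rewrite lt_min => /andP[yd yd'].
      exact: d'P.
    exact: (dP m y mN Ay yd).
  have [Ax'|nAx] := pselect (a N x).
    have /subspace_continuousP/(_ x Ax') := ck N.
    move=> /metricType_numDomainType.cvgrPdist_lt/(_ e e0); rewrite near_withinE.
    move=> /nbhs_ballP[d' d'0 d'P]; exists d' => // y Ay xy.
    by rewrite -[x in mdist x _]kx; apply: d'P; rewrite // ballEmdist.
  have [d' d'0 d'P] := (metric_openP _).1 (closed_openC (arc_closed (hg N))) x nAx.
  by exists d' => // y Ay /d'P.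
exists (Num.min d r); first by rewrite /= lt_min d0.
move=> y; rewrite ballEmdist /= lt_min => /andP[yd yr]; rewrite kx.
have [m Am] := cover y.
have [[z [Az Sz]]|nz] := pselect (exists z, a m z /\ S z).
  have [m' m'N Uz] := NP z Sz.
  by apply: (dP m') => //; rewrite (overlap_eq Uz Az).
apply: lt_trans re.
(* An arc that misses the sphere [S] and has a point inside it lies inside. *)
have in_ball : a m `&` [set z | mdist x z < r] = a m.
  apply: (arc_connected (hg m)); first by exists y.
  - exists [set z | mdist x z < r] => //.
    by have := metric_ball_open x r; rewrite ballEmdist.
  - exists [set z | mdist x z <= r].
      exact: ((continuous_closedP _).1 mc _ (@closed_le _ r)).
    apply/seteqP; split=> z [Az]; rewrite /= => zr; split=> //; first exact: ltW.
    rewrite lt_neqAle zr andbT; apply/eqP => e'; apply: nz; by exists z.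
have : a m (k y) by apply: ka; exists y.
by rewrite -in_ball => -[].
Qed.

(** Two different arcs meet only at ends, where the maps are the identity, so the
    map may be computed on any arc that contains the point. *)
Lemma glue_homeo (th th' : nat -> X -> X) :
  (forall n, homeomorphism_on (a n) (a n) (th n) (th' n)) ->
  (forall n i, a n (endpoint i) -> th n (endpoint i) = endpoint i) ->
  (forall n m, a n = a m -> th n = th m /\ th' n = th' m) ->
  exists k : homeo cX, forall n x, a n x -> k x = th n x.
Proof.
move=> thP th_end th_eq; have [N NP] := choice cover.
have end_fixed n x : a n x -> (exists i, x = endpoint i) -> th n x = x.
  by move=> Ax [i e]; rewrite e in Ax *; exact: th_end.
have end_fixed' n x : a n x -> (exists i, x = endpoint i) -> th' n x = x.
  move=> Ax ex; have [_ _ _ thK _] := thP n.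
  by rewrite -{1}(end_fixed n x) // thK // inE.
have kE n x : a n x -> th (N x) x = th n x /\ th' (N x) x = th' n x.
  move=> Ax; have [Ux|ex] := interior_or_end (NP x).
    by have [-> ->] := th_eq _ _ (overlap_eq Ux Ax).
  by rewrite !end_fixed ?end_fixed' //.
have ks n x : a n x -> a n (th n x).
  by case: (thP n) => _ s _ _ _ Ax; apply: s; exists x.
have ks' n x : a n x -> a n (th' n x).
  by case: (thP n) => _ _ s _ _ Ax; apply: s; exists x.
have kc : continuous (fun x => th (N x) x).
  apply: glue_continuous => [n|n _ [x Ax <-]|i].
  - have [[c _] _ _ _ _] := thP n; apply: within_eq c _ => x Ax.
    by have [] := kE n x Ax.
  - by have [-> _] := kE n x Ax; exact: ks.
  - by rewrite end_fixed //; exists i.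
have kc' : continuous (fun x => th' (N x) x).
  apply: glue_continuous => [n|n _ [x Ax <-]|i].
  - have [[_ c] _ _ _ _] := thP n; apply: within_eq c _ => x Ax.
    by have [] := kE n x Ax.
  - by have [_ ->] := kE n x Ax; exact: ks'.
  - by rewrite end_fixed' //; exists i.
have kK : cancel (fun x => th (N x) x) (fun x => th' (N x) x).
  move=> x; have Ax := NP x; have [_ ->] := kE _ _ (ks _ _ Ax).
  by have [_ _ _ thK _] := thP (N x); rewrite thK // inE.
have kK' : cancel (fun x => th' (N x) x) (fun x => th (N x) x).
  move=> x; have Ax := NP x; have [-> _] := kE _ _ (ks' _ _ Ax).
  by have [_ _ _ _ thK] := thP (N x); rewrite thK // inE.
by exists (Homeo cX kc kc' kK kK') => n x /kE[].
Qed.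

(** * Genericity and conjugacy of homeomorphisms *)

Lemma chart_subproof (f : homeo cX) n : exists F : unit_auto R,
  forall t, 0 <= t <= 1 -> h n (F t) = f (h n t).
Proof. by have [fA f0 f1] := rigid f n; exact: (arc_chart_exists (hg n)). Qed.

Definition chart (f : homeo cX) n : unit_auto R := sval (cid (chart_subproof f n)).

Lemma chartE f n t : 0 <= t <= 1 -> h n (chart f n t) = f (h n t).
Proof. by rewrite /chart; case: cid => F /= FE; exact: FE. Qed.

Lemma chart_uniq (f : homeo cX) n (F : unit_auto R) :
  (forall t, 0 <= t <= 1 -> h n (F t) = f (h n t)) -> forall t, F t = chart f n t.
Proof.
move=> FE t; have [t01|] := boolP (0 <= t <= 1).
  by apply: (arc_inj (hg n)); rewrite ?ua_cc // chartE // FE.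
move=> nt; rewrite !ua_out //; apply: contra nt => /andP[t0 t1]; rewrite !ltW //.
Qed.

Definition generic_homeo (f : homeo cX) := forall n, generic (chart f n).

Lemma chart_conj (f f' k : homeo cX) n :
  homeo_fun f' \o homeo_fun k = homeo_fun k \o homeo_fun f ->
  forall t, chart k n (chart f n t) = chart f' n (chart k n t).
Proof.
move=> e t.
have [t01|nt] := boolP (0 <= t <= 1); last first.
  have nt' : ~~ (0 < t < 1) by apply: contra nt => /andP[t0 t1]; rewrite !ltW.
  by rewrite !ua_out.
apply: (arc_inj (hg n)); rewrite ?ua_cc // !chartE ?ua_cc //.
by have := congr1 (@^~ (h n t)) e => /= ->.
Qed.

Lemma generic_homeo_conj f f' : generic_homeo f -> conjugate f' f -> generic_homeo f'.
Proof.
move=> gf [k e] n; exact: (generic_conjugation (gf n) (chart_conj n e)).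
Qed.

(** Conjugacies of the charts are chosen for each arc as a subset of [X] rather than
    for each index, so that an arc listed under several indices, possibly with
    different parametrizations, receives one map. *)
Lemma generic_homeo_conjugate f f' :
  generic_homeo f -> generic_homeo f' -> conjugate f' f.
Proof.
move=> gf gf'.
pose conj n (H : unit_auto R) := forall t, H (chart f n t) = chart f' n (H t).
have ex (A : set X) : exists nH : nat * unit_auto R,
    (exists n, a n = A) -> a nH.1 = A /\ conj nH.1 nH.2.
  have [[n nA]|nex] := pselect (exists n, a n = A).
    have [H HE] := generic_conjugate (gf' n) (gf n).
    by exists (n, H).
  have [H _] := generic_conjugate (gf 0%N) (gf 0%N).
  by exists (0%N, H).
have [c cP] := choice ex.
pose N n := (c (a n)).1; pose H n := (c (a n)).2.
have aN n : a (N n) = a n by have [] := cP (a n) (ex_intro _ n erefl).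
have HP n : conj (N n) (H n) by have [] := cP (a n) (ex_intro _ n erefl).
pose th phi n := arc_act (a (N n)) (h (N n)) (g (N n)) (phi (H n)).
have thE phi n t : 0 <= t <= 1 -> th phi n (h (N n) t) = h (N n) (phi (H n) t).
  by move=> t01; rewrite /th arc_actE ?(arcK (hg _)) //; exact: (arc_in (hg _)).
have th_in phi n : th phi n @` a n `<=` a n.
  move=> _ [x Ax <-]; rewrite -(aN n) in Ax *.
  rewrite /th arc_actE //; apply: (arc_in (hg _)).
  by rewrite ua_cc; exact: (arc_coord (hg _)).
have [k kE] : exists k : homeo cX, forall n x, a n x -> k x = th id n x.
  apply: (@glue_homeo _ (th (@uaV R))).
  - move=> n; split; [split|exact: th_in|exact: th_in|..].
    + by apply: continuous_subspaceT; exact: (arc_act_continuous (hg _)).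
    + by apply: continuous_subspaceT; exact: (arc_act_continuous (hg _)).
    + by move=> x _; exact: (arc_actK (hg _)).
    + by move=> x _; exact: (arc_act_invK (hg _)).
  - move=> n i; rewrite -(aN n) => /endpoint_cases[]->.
    + by rewrite thE ?ua0 // lexx ler01.
    + by rewrite thE ?ua1 // lexx ler01.
  - by move=> n m e; rewrite /th /N /H e.
exists k; apply/funext => x /=; have [n Ax] := cover x.
have [fa _ _] := rigid f n.
have Afx : a n (f x) by rewrite -fa; exists x.
rewrite !(kE n) //; rewrite -(aN n) in Ax.
have g01 := arc_coord (hg _) Ax.
rewrite -(arc_invK (hg _) Ax) thE // -(chartE f) // thE ?ua_cc //= HP.
by rewrite chartE ?ua_cc.
Qed.

(** * Genericity is a countable intersection of dense open conditions *)

Lemma chart_open n t (W : set R) : 0 <= t <= 1 -> open W ->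
  open [set f : homeo cX | W (chart f n t)].
Proof.
move=> t01 oW; apply/metric_openP => f /= Wf.
have F01 : 0 <= chart f n t <= 1 by rewrite ua_cc.
have Af : a n (f (h n t)) by rewrite -chartE //; exact: (arc_in (hg n)).
have gf f' : chart f' n t = g n (f' (h n t)).
  by rewrite -chartE // (arcK (hg n)) // ua_cc.
have /subspace_continuousP/(_ _ Af) cg := arc_inv_cont (hg n).
have : nbhs (g n (f (h n t))) W by apply: open_nbhs_nbhs; split; rewrite -?gf.
move=> /cg /nbhs_ballP[d d0 dP]; exists d => // f' ff'.
rewrite gf; apply: dP.
  rewrite ballEmdist /=; apply: le_lt_trans ff'; exact: C0dist_ub.
by rewrite -chartE //; apply: (arc_in (hg n)); rewrite ua_cc.
Qed.

Definition fixed_free (F : unit_auto R) r e := forall t,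
  0 <= t <= 1 -> r - e <= t <= r + e -> F t != t.

Lemma crossing_open n r e : open [set f : homeo cX | crossing (chart f n) r e].
Proof.
apply/metric_openP => f [x [y [z [loc [Fx Fy Fz]]]]].
have moved t : chart f n t != t -> 0 <= t <= 1.
  by move=> /ua_moved/andP[t0 t1]; rewrite !ltW.
have x01 : 0 <= x <= 1 by apply: moved; rewrite gt_eqF.
have y01 : 0 <= y <= 1 by apply: moved; rewrite lt_eqF.
have z01 : 0 <= z <= 1 by apply: moved; rewrite gt_eqF.
have o1 := @chart_open n x [set s | x < s] x01 (@open_gt _ x).
have o2 := @chart_open n y [set s | s < y] y01 (@open_lt _ y).
have o3 := @chart_open n z [set s | z < s] z01 (@open_gt _ z).
have [d d0 dP] := (metric_openP _).1 (openI o1 (openI o2 o3)) f (conj Fx (conj Fy Fz)).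
by exists d => // f' /dP[? [? ?]]; exists x, y, z.
Qed.

(** By compactness a map without fixed points on a closed interval moves all of its
    points by at least a positive amount. *)
Lemma fixed_free_open n r e : open [set f : homeo cX | fixed_free (chart f n) r e].
Proof.
apply/metric_openP => f /= ff.
pose u := Num.max 0 (r - e); pose v := Num.min 1 (r + e).
have [uv|vu] := leP u v; last first.
  exists 1 => // f' _ t /andP[t0 t1] /andP[rt tr].
  have : u <= t <= v by rewrite ge_max le_min t0 t1 rt.
  by move=> /andP[/le_trans h1 /h1]; rewrite leNgt vu.
have uvP t : u <= t <= v -> 0 <= t <= 1 /\ r - e <= t <= r + e.
  by rewrite ge_max le_min => /andP[/andP[-> ->] /andP[-> ->]].
pose D t := mdist (h n t) (f (h n t)).
have cD : {within `[u, v], continuous D}.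
  apply/subspace_continuousP => t; rewrite /= in_itv /= => /uvP[t01 _].
  apply/cvgrPdist_lt => s s0; rewrite near_withinE; apply/nbhs_ballP.
  have s2 : 0 < s / 2 by rewrite divr_gt0.
  have [d1 d10 d1P] := (continuous_mdist f).1 (@homeo_continuous _ _ _ f) (h n t) _ s2.
  have m0 : 0 < Num.min d1 (s / 2) by rewrite lt_min d10.
  have [d d0 dP] := arc_dist (hg n) t01 m0.
  exists d => // t' tt' /=; rewrite in_itv /= => /uvP[t'01 _].
  have := dP t' t'01 tt'; rewrite lt_min => /andP[/d1P h1 h2].
  have h3 := metric_triangle (h n t) (h n t') (f (h n t)).
  have h4 := metric_triangle (h n t') (f (h n t')) (f (h n t)).
  have h5 := metric_triangle (h n t') (h n t) (f (h n t')).
  have h6 := metric_triangle (h n t) (f (h n t)) (f (h n t')).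
  rewrite [mdist (f (h n t')) (f (h n t))]metric_sym in h4.
  rewrite [mdist (h n t') (h n t)]metric_sym in h5.
  by change (`|D t - D t'| < s); rewrite /D ltr_norml; apply/andP; split; lra.
have [c cuv cmin] := EVT_min uv cD.
have /uvP[c01 cr] : u <= c <= v by move: cuv; rewrite in_itv.
have Dc : 0 < D c.
  rewrite /D mdist_gt0 -chartE //; apply/eqP => /(arc_inj (hg n)) H.
  by have := ff c c01 cr; rewrite -H ?ua_cc // eqxx.
exists (D c) => // f' ff' t t01 tr; apply/eqP => e'.
have : D c <= D t.
  by apply: cmin; rewrite in_itv /= ge_max le_min; case/andP: t01 => -> ->.
rewrite leNgt; apply/negP/negPn; rewrite /D -{1}e' chartE // metric_sym.
by apply: le_lt_trans ff'; exact: C0dist_ub.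
Qed.

(** A point moved by the action of [phi], and its image, both lie in the image of
    the support of [phi]. *)
Lemma arc_act_near n (phi : unit_auto R) u v (P : X -> Prop) y :
  0 <= u -> v <= 1 -> (forall t, ~~ (u < t < v) -> phi t = t) ->
  (forall t, u < t < v -> P (h n t)) ->
  arc_act (a n) (h n) (g n) phi y = y \/
  (P y /\ P (arc_act (a n) (h n) (g n) phi y)).
Proof.
move=> u0 v1 out hP.
have [Ay|nAy] := pselect (a n y); last by left; rewrite arc_act_out.
rewrite arc_actE //; have [guv|/out ->] := boolP (u < g n y < v); last first.
  by left; rewrite (arc_invK (hg n)).
right; split; first by rewrite -(arc_invK (hg n) Ay); exact: hP.
apply: hP; apply: contraT => nuv.
have : phi (g n y) = g n y by rewrite -{1}(uaK phi (phi (g n y))) out // uaK.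
by move=> e; rewrite e guv in nuv.
Qed.

(** Composing [f] with a map supported in a small neighbourhood of the fixed point
    [h n z] changes [f] only by the diameter of this neighbourhood, and the
    inverse of [f] only by the diameter of its preimage.  Within the neighbourhood
    the values at three points can be prescribed by [move3]. *)
Lemma perturb (f : homeo cX) n z (e eps : R) : 0 <= z <= 1 -> chart f n z = z ->
  0 < e -> 0 < eps ->
  exists f' : homeo cX, mdist f f' < eps /\ crossing (chart f' n) z e.
Proof.
move=> z01 Fz e0 eps0; set F := chart f n in Fz *.
have e3 : 0 < eps / 3 by rewrite divr_gt0.
have fz : f (h n z) = h n z by rewrite -chartE // -/F Fz.
have [d1 d10 d1P] := arc_dist (hg n) z01 e3.
have [d2 d20 d2P] := (continuous_mdist (homeo_inv f)).1
  (@homeo_inv_continuous _ _ _ f) (h n z) _ e3.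
have [d3 d30 d3P] := arc_dist (hg n) z01 d20.
pose d := Num.min e (Num.min d1 d3).
have d0 : 0 < d by rewrite !lt_min e0 d10.
have /andP[z0 z1] := z01.
pose u := Num.max 0 (z - d); pose v := Num.min 1 (z + d).
have u0 : 0 <= u by rewrite le_max lexx.
have v1 : v <= 1 by rewrite ge_min lexx.
have uz : u <= z by rewrite ge_max z0 gerBl ltW.
have zv : z <= v by rewrite le_min z1 lerDl ltW.
have uv : u < v by rewrite gt_max !lt_min ltr01 /= (ltr_wpDl z0 d0) /=; lra.
have hP t : u < t < v -> mdist (h n z) (h n t) < eps / 3 /\
    mdist (h n z) (homeo_inv f (h n t)) < eps / 3.
  rewrite gt_max lt_min => /andP[/andP[t0 zt] /andP[t1 tz]].
  have t01 : 0 <= t <= 1 by rewrite !ltW.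
  have : `|z - t| < d by rewrite ltr_norml; apply/andP; split; lra.
  rewrite !lt_min => /and3P[_ zt1 zt3]; split; first exact: d1P.
  by rewrite -[X in mdist X _](homeoK f) fz; apply/d2P/d3P.
have ue : z - e <= u.
  by rewrite le_max; apply/orP; right; rewrite lerD2l lerN2 !ge_min lexx.
have ve : v <= z + e.
  by rewrite ge_min; apply/orP; right; rewrite lerD2l !ge_min lexx.
clearbody u v.
pose V := ua_inv F; have Vz : V z = z by rewrite -{1}Fz /V uaK.
have Vuv : V u < V v by rewrite ua_inv_lt.
have uVv : u < V v.
  have := uz; rewrite le_eqVlt => /orP[/eqP e'|uz'].
    by rewrite e' -{1}Vz ua_inv_lt -e'.
  by apply: (lt_le_trans uz'); rewrite -{1}Vz leNgt ua_inv_lt -leNgt.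
have Vuv' : V u < v.
  have := zv; rewrite le_eqVlt => /orP[/eqP e'|zv'].
    by rewrite -e' -{1}Vz ua_inv_lt e'.
  by apply: le_lt_trans zv'; rewrite -{1}Vz leNgt ua_inv_lt -leNgt.
pose u1 := Num.max u (V u); pose v1' := Num.min v (V v).
have uv1 : u1 < v1' by rewrite gt_max !lt_min uv uVv Vuv' Vuv.
have [uu1 Vuu1] : u <= u1 /\ V u <= u1 by rewrite !le_max !lexx orbT.
have [vv1 Vvv1] : v1' <= v /\ v1' <= V v by rewrite !ge_min !lexx orbT.
(* Between [u1] and [v1'] both [t] and [F t] lie in the support; six points of it are
   needed, three arguments and three values. *)
pose w := (v1' - u1) / 7; have w0 : 0 < w by rewrite divr_gt0 // subr_gt0.
have wE : v1' = u1 + 7 * w by rewrite /w; lra.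
have [phi [p1 p4 p5 out]] : exists phi : unit_auto R,
    [/\ phi (F (u1 + w)) = u1 + 2 * w, phi (F (u1 + 4 * w)) = u1 + 3 * w,
      phi (F (u1 + 5 * w)) = u1 + 6 * w & forall t, ~~ (u < t < v) -> phi t = t].
  apply: move3 => //; split; rewrite ?ua_lt; try lra.
  - rewrite ua_inv_gt -/V; lra.
  - rewrite ua_lt_inv -/V; lra.
pose k := arc_homeo cX (hg n) (oU n) phi.
have out' t : ~~ (u < t < v) -> uaV phi t = t.
  by move=> tuv; rewrite /= -{1}(out t tuv) uaK.
pose f' := homeo_comp k f.
have cf' t : chart f' n t = phi (F t).
  apply/esym; apply: (@chart_uniq f' n (ua_comp phi F)) => s s01 /=.
  rewrite -chartE // /k /= arc_actE; last by apply: (arc_in (hg n)); rewrite ua_cc.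
  by rewrite (arcK (hg n)) // ua_cc.
exists f'; split.
  have le : C0dist f f' <= eps / 3 + eps / 3.
    apply: C0dist_le => [|x|x]; first by rewrite addr_ge0 // ltW.
    - rewrite /f' /=.
      have [->|[h1 h2]] := @arc_act_near n phi u v
        (fun y => mdist (h n z) y < eps / 3) (f x) u0 v1 out
        (fun t tuv => (hP t tuv).1).
        by rewrite mdistxx addr_ge0 // ltW.
      apply: le_trans (metric_triangle _ (h n z) _) _.
      by rewrite lerD // ?[mdist (f x) _]metric_sym ltW.
    - rewrite /f' /=.
      have [->|[h1 h2]] := @arc_act_near n (uaV phi) u v
        (fun y => mdist (h n z) (homeo_inv f y) < eps / 3) x u0 v1 out'
        (fun t tuv => (hP t tuv).2).
        by rewrite mdistxx addr_ge0 // ltW.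
      apply: le_trans (metric_triangle _ (h n z) _) _.
      by rewrite lerD // ?[mdist (homeo_inv f x) _]metric_sym ltW.
  apply: le_lt_trans le _; lra.
exists (u1 + w), (u1 + 4 * w), (u1 + 5 * w); rewrite !cf' p1 p4 p5.
by split; split; lra.
Qed.

(** The factor 2 leaves room for the neighbourhood of radius [e] of any fixed point
    within distance [e] of [r]. *)
Definition near_generic n r e := [set f : homeo cX | fixed_free (chart f n) r e]
  `|` [set f : homeo cX | crossing (chart f n) r (2 * e)].

Lemma near_generic_open n r e : open (near_generic n r e).
Proof. by apply: openU; [exact: fixed_free_open|exact: crossing_open]. Qed.

Lemma crossing_widen (F : unit_auto R) r r' e e' : crossing F r e ->
  r' - e' <= r - e -> r + e <= r' + e' -> crossing F r' e'.
Proof.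
move=> [x [y [z [[rx xy yz zr] sgn]]]] l1 l2; exists x, y, z; split=> //.
by split=> //; [exact: le_lt_trans rx|exact: lt_le_trans l2].
Qed.

Lemma fixed_free_or_fixed (F : unit_auto R) r e : fixed_free F r e \/
  exists z, [/\ 0 <= z <= 1, r - e <= z <= r + e & F z = z].
Proof.
have [ff|nff] := pselect (fixed_free F r e); [by left|right].
apply: contrapT => H; apply: nff => t t01 tr; apply/eqP => Ft; apply: H.
by exists t.
Qed.

Lemma near_generic_dense n r e : 0 < e -> dense (near_generic n r e).
Proof.
move=> e0 O [f Of] oO.
have [d d0 dO] := (metric_openP _).1 oO f Of.
have [ff|[z [z01 /andP[rz zr] Fz]]] := fixed_free_or_fixed (chart f n) r e.
  by exists f; split=> //; left.
have [f' [ff' cf']] := perturb z01 Fz e0 d0.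
exists f'; split; first exact: dO.
by right; apply: crossing_widen cf' _ _; lra.
Qed.

Lemma generic_near_generic f n r e : generic_homeo f -> 0 < e -> near_generic n r e f.
Proof.
move=> gf e0.
have [ff|[z [z01 /andP[rz zr] Fz]]] := fixed_free_or_fixed (chart f n) r e.
  by left.
by right; apply: crossing_widen (gf n z z01 Fz e e0) _ _; lra.
Qed.

Lemma near_generic_crossing f n t r e e' : near_generic n r e f ->
  0 <= t <= 1 -> chart f n t = t -> t - e < r -> r < t + e -> 3 * e < e' ->
  crossing (chart f n) t e'.
Proof.
move=> nf t01 Ft tr rt ee'; case: nf => [ff|c].
  have : chart f n t != t by apply: ff => //; apply/andP; split; lra.
  by rewrite Ft eqxx.
by apply: crossing_widen c _ _; lra.
Qed.

Lemma generic_homeoP f : generic_homeo f <->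
  forall n (r : rat) (k : nat), near_generic n (ratr r) (k.+1%:R^-1) f.
Proof.
split=> [gf n r k|gf n t t01 Ft e e0].
  by apply: generic_near_generic => //; rewrite invr_gt0 ltr0n.
pose k := Num.truncn (3 / e); have k0 : 0 < k.+1%:R^-1 :> R by rewrite invr_gt0 ltr0n.
have ke : 3 * k.+1%:R^-1 < e.
  by rewrite ltr_pdivrMr ?ltr0n // mulrC -ltr_pdivrMr //; exact: truncnS_gt.
have [|r] := @rat_in_itvoo R (t - k.+1%:R^-1) (t + k.+1%:R^-1).
  by rewrite ltrBlDr -addrA ltrDl addr_gt0.
rewrite in_itv /= => /andP[tr rt].
exact: near_generic_crossing (gf n r k) t01 Ft tr rt ke.
Qed.

(** The identity shows that the space is nonempty, so density provides a generic
    homeomorphism, whose class consists of all generic homeomorphisms. *)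
Lemma generic_class_comeager :
  exists f : homeo cX, Gdelta (conjugacy_class f) /\ dense (conjugacy_class f).
Proof.
pose O i := if unpickle i is Some (n, r, k)
  then near_generic n (ratr r) ((k : nat).+1%:R^-1) else setT.
have oO i : open (O i).
  rewrite /O; case: unpickle => [[[n r] k]|]; [exact: near_generic_open|exact: openT].
have dO i : dense (O i).
  rewrite /O; case: unpickle => [[[n r] k]|].
    by apply: near_generic_dense; rewrite invr_gt0 ltr0n.
  by move=> W [x Wx] _; exists x.
have gE : generic_homeo = \bigcap_i O i.
  apply/seteqP; split=> f.
    move=> /generic_homeoP gf i _; rewrite /O; case: unpickle => [[[n r] k]|//].
    exact: gf.
  move=> Of; apply/generic_homeoP => n r k.
  by have := Of (pickle (n, r, k)) I; rewrite /O pickleK.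
have dG : dense generic_homeo.
  by rewrite gE; apply: metric_Baire oO dO; exact: homeo_complete.
have cid : continuous (@id X) by move=> x; exact: cvg_id.
have idK : cancel (@id X) id by [].
have [|f [_ gf]] := dG setT _ openT; first by exists (Homeo cX cid cid idK idK).
have cE : conjugacy_class f = generic_homeo.
  apply/seteqP; split=> f' /=.
    exact: generic_homeo_conj.
  exact: generic_homeo_conjugate.
by exists f; rewrite cE; split=> //; rewrite gE; exists O.
Qed.

End Family.

Theorem proposition3p1 (R : realType) (X : metricType R)
    (cX : compact [set: X])
    (a : nat -> set X) (p q : nat -> X)
    (a_cover : [set: X] = \bigcup_n a n)
    (a_arc : forall n, compact_arc R (a n) (p n) (q n))
    (a_free : forall n, free_arc R (a n `\` [set p n; q n]))
    (a_fixed : forall (f : homeo cX) (n : nat),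
      [/\ f @` a n = a n, f (p n) = p n & f (q n) = q n]) :
  exists f : homeo cX,
    Gdelta (conjugacy_class f) /\ dense (conjugacy_class f).
Proof.
have [h hP] := choice a_arc; have [g hg] := choice hP.
apply: (@generic_class_comeager _ _ cX a h g) => [n|x|n|f n].
- by have [] := hg n.
- by have : [set: X] x by []; rewrite a_cover => -[n _ Ax]; exists n.
- by have [_ -> ->] := hg n; have [] := a_free n.
- by have [_ -> ->] := hg n; exact: a_fixed.
Qed.
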